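(* For each $N\in\mathbb{N}$ let $\theta_k=\theta_k^{(N)}\in\mathbb{C}$ and $\epsilon_k=\epsilon_k^{(N)}\in\mathbb{C}$, $1\le k\le N$, be given, and put $$f_k(z):=\frac{\rho_k z}{1-z}+\epsilon_k^2,\qquad \rho_k=e^{2\pi i\theta_k}.$$ Suppose $\{\theta_k\}$ and $\{\epsilon_k\}$ satisfy any one of the following: (1) $\theta_k=\frac1N+O\left(\frac1{N^3}\right)$ and $\epsilon_k=O\left(\frac1{N^2}\right)$; (2) $\theta_k=\frac1N+\frac{c_k}{N^2}$ with $c_k\in\mathbb{C}$ uniformly bounded and $c_k+c_{k+1}=O\left(\frac1N\right)$ for odd $k$, and $\epsilon_k=O\left(\frac1{N^2}\right)$; (3) $\theta_k=\frac1N+\frac{Ce^{2\pi ik/N}}{N^2}$, where $C$ is any constant in $\mathbb{C}$, and $\epsilon_k=O\left(\frac1{N^2}\right)$; (4) $\theta_k=0$ and $\epsilon_k=\frac{\pi}{N}+O\left(\frac1{N^3}\right)$; (5) $\theta_k=0$ and $\epsilon_k=\frac{\pi}{N}+\frac{c_k}{N^2}$ with $c_k$ uniformly bounded and $c_k+c_{N-k}=O\left(\frac1N\right)$ for $1\le k\le N-1$. Then $f_N\circ f_{N-1}\circ\cdots\circ f_1\to\mathrm{Id}$ as $N\to\infty$, uniformly on compact subsets of $\mathbb{C}$.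
   Context: The quantities $\theta_k,\epsilon_k,c_k$ (hence $\rho_k$ and $f_k$) may depend on $N$ as well as on $k$; the constant $C$ in (3) does not. ''Uniformly bounded'' and the $O(\cdot)$ terms are uniform in $k$ and $N$. The $f_k$ are regarded as Möbius transformations of the Riemann sphere, so that compositions are always defined. *)

(* Defs.v *)
From Stdlib Require Import Reals Arith List ClassicalEpsilon.
From Coquelicot Require Import Coquelicot.

Open Scope C_scope.

(* Stdlib and Coquelicot provide no exponential on C; this is
   e^(x + i y) = e^x (cos y + i sin y). *)
Definition Cexp (z : C) : C :=
  ((exp (Re z) * cos (Im z))%R, (exp (Re z) * sin (Im z))%R).

Notation rsphere := (option C) (only parsing).
Notation fin := (@Some C) (only parsing).
Notation infty := (@None C) (only parsing).

(* The Moebius transformation z |-> rho z / (1 - z) + eps^2 of the Riemann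
   sphere, with [None] the point at infinity: it has its pole at 1 and maps
   infinity to - rho + eps^2. *)
Definition fmap (theta eps : C) (z : rsphere) : rsphere :=
  let rho := Cexp (2 * PI * Ci * theta) in
  match z with
  | Some x =>
      if excluded_middle_informative (x = 1) then infty
      else fin (rho * x / (1 - x) + eps ^ 2)
  | None => fin (- rho + eps ^ 2)
  end.

(* [fcomp theta eps n] is f_n o ... o f_1, where f_k = fmap (theta k) (eps k). *)
Fixpoint fcomp (theta eps : nat -> C) (n : nat) (z : rsphere) : rsphere :=
  match n with
  | O => z
  | S m => fmap (theta (S m)) (eps (S m)) (fcomp theta eps m z)
  end.

(* Triangular arrays are functions [a N k]; only the entries with
   1 <= k <= N are meaningful. *)
Definition in_range (N k : nat) : Prop := (1 <= k <= N)%nat.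

(* a N k = O(1 / N^p), uniformly over the pairs (N, k) in D; D is meant to be
   contained in [in_range], so that N >= 1. *)
Definition bigO_inv (D : nat -> nat -> Prop) (a : nat -> nat -> C) (p : nat) :
    Prop :=
  exists M : R, forall N k : nat, D N k -> (Cmod (a N k) <= M / INR N ^ p)%R.

Definition unif_bounded (a : nat -> nat -> C) : Prop :=
  exists M : R, forall N k : nat, in_range N k -> (Cmod (a N k) <= M)%R.

Definition compact_set (K : C -> Prop) : Prop :=
  forall (I : Type) (U : I -> C -> Prop),
    (forall i, open (U i)) ->
    (forall z, K z -> exists i, U i z) ->
    exists l : list I, forall z, K z -> exists i, In i l /\ U i z.

(* Uniform convergence on compact subsets of C of sphere-valued maps to a
   C-valued map: eventually all values on the compact set are finite and
   uniformly close to the limit. *)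
Definition cvg_unif_on_compacts (F : nat -> rsphere -> rsphere) (g : C -> C) :
    Prop :=
  forall K : C -> Prop, compact_set K ->
  forall e : R, (0 < e)%R ->
  eventually (fun N => forall z : C, K z ->
    exists w : C, F N (fin z) = fin w /\ (Cmod (w - g z) < e)%R).

(* Main.v *)
Require Import Defs.
From Stdlib Require Import Reals Arith Lra Lia Psatz List ClassicalEpsilon.
From Coquelicot Require Import Coquelicot.

Open Scope C_scope.

(* In the projective coordinates (X, Y / N) each f_k is the matrix
   [[rho_k - eps_k^2, N eps_k^2], [- 1 / N, 1]], an O(1 / N^2) perturbation of a
   reference matrix B whose powers B^n, n <= N, are bounded and for which B^N is
   exactly scalar.  In cases (1)-(3), B has rho = e^(2 pi i / N), eps = 0 and
   B^N = 1; in cases (4)-(5), B has rho = 1, eps = 2 sin (pi / 2N), hence trace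
   2 cos (pi / N) and determinant 1, and B^N = -1.  By Duhamel's formula the
   composition is scalar up to O(1 / N), which suffices for all entries except
   the lower left one: undoing the scaling multiplies it by N.  The first-order
   term of that entry is a weighted sum of the perturbations, and it is
   O(1 / N^2): trivially in (1) and (4), by pairing consecutive steps in (2), by
   orthogonality of roots of unity in (3), and by the symmetry k <-> N - k of the
   weights in (5). *)

(** * Modulus estimates *)

Lemma Cmod_plus_le (a b : C) (A B : R) :
  (Cmod a <= A -> Cmod b <= B -> Cmod (a + b) <= A + B)%R.
Proof. intros; pose proof (Cmod_triangle a b); lra. Qed.

Lemma Cmod_minus_le (a b : C) (A B : R) :
  (Cmod a <= A -> Cmod b <= B -> Cmod (a - b) <= A + B)%R.
Proof.
  intros; unfold Cminus; apply Cmod_plus_le; [| rewrite Cmod_opp]; assumption.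
Qed.

Lemma Cmod_mult_le (a b : C) (A B : R) :
  (Cmod a <= A -> Cmod b <= B -> Cmod (a * b) <= A * B)%R.
Proof.
  intros; rewrite Cmod_mult; apply Rmult_le_compat; auto using Cmod_ge_0.
Qed.

Lemma Cmod_le_plus_dist (y z : C) : (Cmod y <= Cmod z + Cmod (y - z))%R.
Proof.
  replace y with (z + (y - z)) at 1 by ring. apply Cmod_triangle.
Qed.

Lemma RtoC_neq_0 (r : R) : r <> 0%R -> RtoC r <> 0.
Proof. intros H E; apply H, RtoC_inj, E. Qed.

Lemma INR_ge_1 (N : nat) : (0 < N)%nat -> (1 <= INR N)%R.
Proof. intros; apply (le_INR 1); lia. Qed.

Lemma INR_C_neq_0 (N : nat) : (0 < N)%nat -> RtoC (INR N) <> 0.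
Proof. intros; apply RtoC_neq_0, not_0_INR; lia. Qed.

Lemma Cmod_inv_INR (N : nat) : (0 < N)%nat -> Cmod (/ INR N) = (/ INR N)%R.
Proof.
  intros HN. pose proof (INR_ge_1 N HN).
  rewrite Cmod_inv, Cmod_R, Rabs_pos_eq; [easy | lra | apply INR_C_neq_0, HN].
Qed.

(** * Finite complex sums, Duhamel's formula and the reference model *)

Fixpoint csum (f : nat -> C) (n : nat) : C :=
  match n with O => 0 | S m => csum f m + f m end.

Lemma csum_ext (f g : nat -> C) (n : nat) :
  (forall k, (k < n)%nat -> f k = g k) -> csum f n = csum g n.
Proof.
  induction n; intros H; simpl; [easy |].
  rewrite IHn, H by (intros; try apply H; lia); easy.
Qed.

Lemma csum_plus (f g : nat -> C) (n : nat) :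
  csum (fun k => f k + g k) n = csum f n + csum g n.
Proof. induction n; simpl; [ring | rewrite IHn; ring]. Qed.

Lemma csum_scal (z : C) (f : nat -> C) (n : nat) :
  csum (fun k => z * f k) n = z * csum f n.
Proof. induction n; simpl; [ring | rewrite IHn; ring]. Qed.

Lemma csum_le (f : nat -> C) (n : nat) (B : R) :
  (forall k, (k < n)%nat -> (Cmod (f k) <= B)%R) ->
  (Cmod (csum f n) <= INR n * B)%R.
Proof.
  induction n; intros H; cbn [csum].
  - rewrite Cmod_0; simpl; lra.
  - replace (INR (S n) * B)%R with (INR n * B + B)%R by (rewrite S_INR; ring).
    apply Cmod_plus_le; [apply IHn; intros |]; apply H; lia.
Qed.

Lemma csum_S_l (f : nat -> C) (n : nat) :
  csum f (S n) = f O + csum (fun k => f (S k)) n.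
Proof.
  induction n; [simpl; ring |].
  change (csum f (S (S n))) with (csum f (S n) + f (S n)).
  rewrite IHn; simpl; ring.
Qed.

Lemma csum_rev (f : nat -> C) (n : nat) :
  csum f n = csum (fun k => f (n - 1 - k)%nat) n.
Proof.
  induction n; [easy |].
  rewrite (csum_S_l (fun k => f (S n - 1 - k)%nat)).
  cbn [csum]; rewrite IHn, Cplus_comm.
  f_equal; [f_equal; lia |].
  apply csum_ext; intros; f_equal; lia.
Qed.

(** Variation of constants. The forcing [w] enters the first coordinate only, so the sums involve
    just the first column [a], [c] of the matrix powers. *)
Lemma duhamel (al be ga : C) (a b c d x y w : nat -> C) :
  a O = 1 -> b O = 0 -> c O = 0 -> d O = 1 ->
  (forall n, a (S n) = al * a n + be * c n) ->
  (forall n, b (S n) = al * b n + be * d n) ->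
  (forall n, c (S n) = ga * a n + c n) ->
  (forall n, d (S n) = ga * b n + d n) ->
  (forall n, x (S n) = al * x n + be * y n + w n) ->
  (forall n, y (S n) = ga * x n + y n) ->
  forall n,
    x n = a n * x O + b n * y O + csum (fun k => a (n - 1 - k)%nat * w k) n /\
    y n = c n * x O + d n * y O + csum (fun k => c (n - 1 - k)%nat * w k) n.
Proof.
  intros a0 b0 c0 d0 aS bS cS dS xS yS.
  induction n as [| n [IHx IHy]].
  - rewrite a0, b0, c0, d0; simpl; split; ring.
  - rewrite xS, yS, aS, bS, cS, dS.
    (* The newest forcing term is propagated by the zeroth power: it contributes [w n] to the first
       coordinate and nothing to the second. *)
    cbn [csum]. replace (S n - 1 - n)%nat with O by lia. rewrite a0, c0.
    split.
    + rewrite (csum_ext (fun k => a (S n - 1 - k)%nat * w k)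
        (fun k => al * (a (n - 1 - k)%nat * w k) + be * (c (n - 1 - k)%nat * w k))).
      * rewrite csum_plus, !csum_scal, IHx, IHy; ring.
      * intros k Hk. replace (S n - 1 - k)%nat with (S (n - 1 - k)) by lia.
        rewrite aS; ring.
    + rewrite (csum_ext (fun k => c (S n - 1 - k)%nat * w k)
        (fun k => ga * (a (n - 1 - k)%nat * w k) + c (n - 1 - k)%nat * w k)).
      * rewrite csum_plus, !csum_scal, IHx, IHy; ring.
      * intros k Hk. replace (S n - 1 - k)%nat with (S (n - 1 - k)) by lia.
        rewrite cS; ring.
Qed.

(* The projective coordinates (X, Y) of the orbit of z are rescaled to
   (x, y) = (X, Y / N), so that one step of the orbit is the matrix
   [[rho - eps^2, N eps^2], [- 1 / N, 1]].  It is compared with the constant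
   matrix [[al, be], [- 1 / N, 1]], whose n-th power is
   [[a n, b n], [c n, d n]] and whose N-th power is the scalar lam.  The
   entries of the difference, [u k] and [v k], belong to step k + 1. *)
Record model (N : nat) (theta eps : nat -> C) (K M Q : R)
    (al be lam : C) (a b c d u v : nat -> C) : Prop := {
  md_ia : a O = 1; md_ib : b O = 0; md_ic : c O = 0; md_id : d O = 1;
  md_aS : forall n, a (S n) = al * a n + be * c n;
  md_bS : forall n, b (S n) = al * b n + be * d n;
  md_cS : forall n, c (S n) = (- / INR N) * a n + c n;
  md_dS : forall n, d (S n) = (- / INR N) * b n + d n;
  md_u : forall k,
    al + u k = Cexp (2 * PI * Ci * theta (S k)) - eps (S k) ^ 2;
  md_v : forall k, be + v k = INR N * eps (S k) ^ 2;
  md_a : forall n, (n <= N)%nat -> (Cmod (a n) <= K)%R;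
  md_b : forall n, (n <= N)%nat -> (Cmod (b n) <= K)%R;
  md_c : forall n, (n <= N)%nat -> (Cmod (c n) <= K)%R;
  md_d : forall n, (n <= N)%nat -> (Cmod (d n) <= K)%R;
  md_ule : forall k, (k < N)%nat -> (Cmod (u k) <= M / INR N ^ 2)%R;
  md_vle : forall k, (k < N)%nat -> (Cmod (v k) <= M / INR N ^ 2)%R;
  md_aN : a N = lam; md_bN : b N = 0; md_cN : c N = 0; md_dN : d N = lam;
  md_lam : Cmod lam = 1%R;
  md_S : (Cmod (csum (fun k => c (N - 1 - k)%nat * (u k * a k + v k * c k))%C N)
          <= Q / INR N ^ 2)%R
}.

(** * A priori and first-order estimates along one orbit *)

Section Orbit.

Variables (N : nat) (theta eps : nat -> C) (K M Q : R).
Variables (al be lam : C) (a b c d u v x y : nat -> C) (z : C) (R0 : R).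
Hypothesis HN : (0 < N)%nat.
Hypothesis Hm : model N theta eps K M Q al be lam a b c d u v.
Hypotheses (HK : (0 <= K)%R) (HM : (0 <= M)%R) (HR : (1 <= R0)%R).
Hypothesis Hz : (Cmod z <= R0)%R.
Hypothesis HNbig : (4 * K * M <= INR N)%R.
Hypotheses (Hx0 : x O = z) (Hy0 : y O = / INR N).
Hypothesis HxS : forall n, x (S n) = (al + u n) * x n + (be + v n) * y n.
Hypothesis HyS : forall n, y (S n) = (- / INR N) * x n + y n.

Let h := INR N.
Let w k := u k * x k + v k * y k.
Let L := (8 * K * R0)%R.
Let D := (K + K * M * L)%R.

Lemma orbit_h_ge1 : (1 <= h)%R.
Proof. apply INR_ge_1, HN. Qed.

Lemma orbit_duhamel (n : nat) :
  x n = a n * z + b n * / INR N + csum (fun k => a (n - 1 - k)%nat * w k) n /\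
  y n = c n * z + d n * / INR N + csum (fun k => c (n - 1 - k)%nat * w k) n.
Proof.
  rewrite <- Hx0, <- Hy0.
  destruct Hm.
  apply (duhamel al be (- / INR N) a b c d x y w); auto.
  intros k; rewrite HxS; unfold w; ring.
Qed.

Lemma orbit_w_le (k : nat) (B : R) :
  (k < N)%nat -> (Cmod (x k) + Cmod (y k) <= B)%R ->
  (Cmod (w k) <= M / h ^ 2 * B)%R.
Proof.
  intros Hk HB. destruct Hm.
  pose proof orbit_h_ge1 as H1.
  assert (0 <= M / h ^ 2)%R by (apply Rdiv_le_0_compat; [lra | apply pow_lt; lra]).
  apply Rle_trans with (M / h ^ 2 * Cmod (x k) + M / h ^ 2 * Cmod (y k))%R.
  - apply Cmod_plus_le; apply Cmod_mult_le; try apply Rle_refl; auto.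
  - rewrite <- Rmult_plus_distr_l. apply Rmult_le_compat_l; auto.
Qed.

(** A discrete Gronwall argument by strong induction. In each coordinate the two initial terms cost
    at most [2 * K * R0], and the forcing sum costs at most [L / 4] because [4 * K * M <= N]; the
    two coordinates together give [4 * K * R0 + L / 2 = L]. *)
Lemma orbit_le (n : nat) :
  (n <= N)%nat -> (Cmod (x n) + Cmod (y n) <= L)%R.
Proof.
  induction n as [n IH] using (well_founded_induction lt_wf); intros Hn.
  destruct (orbit_duhamel n) as [Ex Ey].
  pose proof orbit_h_ge1 as H1.
  assert (HiN : Cmod (/ INR N) = (/ h)%R) by apply (Cmod_inv_INR N HN).
  assert (Hih : (/ h <= R0)%R).
  { apply Rle_trans with 1%R; [| lra]. rewrite <- Rinv_1.
    apply Rinv_le_contravar; lra. }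
  assert (Hh2 : (0 < h ^ 2)%R) by (apply pow_lt; lra).
  assert (HL : (0 <= L)%R) by (unfold L; apply Rmult_le_pos; lra).
  assert (Hsum : forall p : nat -> C,
    (forall j, (j <= N)%nat -> (Cmod (p j) <= K)%R) ->
    (Cmod (csum (fun k => p (n - 1 - k)%nat * w k)%C n) <= L / 4)%R).
  { intros p Hp.
    apply Rle_trans with (INR n * (K * (M / h ^ 2 * L)))%R.
    - apply csum_le; intros k Hk. apply Cmod_mult_le; [apply Hp; lia |].
      apply orbit_w_le; [lia |]. apply IH; lia.
    - apply Rle_trans with (h * (K * (M / h ^ 2 * L)))%R.
      + apply Rmult_le_compat_r; [| apply le_INR; lia].
        auto using Rmult_le_pos, Rdiv_le_0_compat.
      + replace (h * (K * (M / h ^ 2 * L)))%R with (4 * K * M / h * (L / 4))%R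
          by (field; lra).
        apply Rle_trans with (1 * (L / 4))%R; [| lra].
        apply Rmult_le_compat_r; [lra |].
        apply Rle_div_l; [lra |]. fold h in HNbig; lra. }
  destruct Hm.
  assert (Hx : (Cmod (x n) <= K * R0 + K * R0 + L / 4)%R).
  { rewrite Ex. repeat apply Cmod_plus_le; auto;
    apply Cmod_mult_le; auto. rewrite HiN; auto. }
  assert (Hy : (Cmod (y n) <= K * R0 + K * R0 + L / 4)%R).
  { rewrite Ey. repeat apply Cmod_plus_le; auto;
    apply Cmod_mult_le; auto. rewrite HiN; auto. }
  unfold L in *; lra.
Qed.

Lemma orbit_csum_le (p : nat -> C) (n : nat) :
  (n <= N)%nat -> (forall j, (j <= N)%nat -> (Cmod (p j) <= K)%R) ->
  (Cmod (csum (fun k => (p (n - 1 - k)%nat * w k)%C) n) <= K * M * L / h)%R.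
Proof.
  intros Hn Hp. pose proof orbit_h_ge1 as H1.
  assert (Hh2 : (0 < h ^ 2)%R) by (apply pow_lt; lra).
  assert (HL : (0 <= L)%R) by (unfold L; apply Rmult_le_pos; lra).
  apply Rle_trans with (INR n * (K * (M / h ^ 2 * L)))%R.
  - apply csum_le; intros k Hk. apply Cmod_mult_le; [apply Hp; lia |].
    apply orbit_w_le; [lia |]. apply orbit_le; lia.
  - apply Rle_trans with (h * (K * (M / h ^ 2 * L)))%R.
    + apply Rmult_le_compat_r; [| apply le_INR; lia].
      auto using Rmult_le_pos, Rdiv_le_0_compat.
    + right; field; lra.
Qed.

(** Once [a n * z] is removed from Duhamel's formula, what is left is [b n / N] and a forcing sum,
    both of order [1 / N]. *)
Lemma orbit_x_first_order (n : nat) :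
  (n <= N)%nat -> (Cmod (x n - a n * z) <= D / h)%R.
Proof.
  intros Hn. pose proof orbit_h_ge1 as H1.
  destruct (orbit_duhamel n) as [-> _].
  replace (_ - _) with (b n * / INR N + csum (fun k => a (n - 1 - k)%nat * w k) n)
    by ring.
  replace (D / h)%R with (K * / h + K * M * L / h)%R by (unfold D; field; lra).
  destruct Hm. apply Cmod_plus_le.
  - apply Cmod_mult_le; auto. rewrite (Cmod_inv_INR N HN); fold h; lra.
  - apply orbit_csum_le; auto.
Qed.

Lemma orbit_y_first_order (n : nat) :
  (n <= N)%nat -> (Cmod (y n - c n * z) <= D / h)%R.
Proof.
  intros Hn. pose proof orbit_h_ge1 as H1.
  destruct (orbit_duhamel n) as [_ ->].
  replace (_ - _) with (d n * / INR N + csum (fun k => c (n - 1 - k)%nat * w k) n)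
    by ring.
  replace (D / h)%R with (K * / h + K * M * L / h)%R by (unfold D; field; lra).
  destruct Hm. apply Cmod_plus_le.
  - apply Cmod_mult_le; auto. rewrite (Cmod_inv_INR N HN); fold h; lra.
  - apply orbit_csum_le; auto.
Qed.

Lemma orbit_x_end : (Cmod (x N - lam * z) <= D / h)%R.
Proof. destruct Hm. rewrite <- md_aN0. apply orbit_x_first_order; auto. Qed.

(** The delicate entry: [c N = 0], so the error is [N] times the forcing sum, which therefore has to
    be of order [1 / N ^ 2]. Replacing the orbit by [(a k * z, c k * z)] in the forcing produces
    [z * S1], controlled by [md_S]; the replacement error [S2] consists of [N] terms of order
    [1 / N ^ 3]. *)
Lemma orbit_y_end :
  (Cmod (INR N * y N - lam) <= (R0 * Q + 2 * K * M * D) / h)%R.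
Proof.
  pose proof orbit_h_ge1 as H1.
  assert (Hh2 : (0 < h ^ 2)%R) by (apply pow_lt; lra).
  assert (HD : (0 <= D)%R).
  { unfold D, L; apply Rplus_le_le_0_compat; auto.
    repeat apply Rmult_le_pos; lra. }
  assert (HhC : RtoC (INR N) <> 0) by (apply RtoC_neq_0; fold h; lra).
  destruct (orbit_duhamel N) as [_ ->].
  set (S1 := csum (fun k => c (N - 1 - k)%nat * (u k * a k + v k * c k)) N).
  set (S2 := csum (fun k => c (N - 1 - k)%nat *
               (u k * (x k - a k * z) + v k * (y k - c k * z))) N).
  assert (E : csum (fun k => c (N - 1 - k)%nat * w k) N = z * S1 + S2).
  { unfold S1, S2. rewrite <- csum_scal, <- csum_plus.
    apply csum_ext; intros; unfold w; ring. }
  rewrite E. destruct Hm. rewrite md_cN0, md_dN0.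
  replace (_ - _) with (INR N * (z * S1 + S2)) by (field; auto).
  apply Rle_trans with
    (h * (R0 * (Q / h ^ 2) + h * (K * (M / h ^ 2 * (D / h) + M / h ^ 2 * (D / h)))))%R.
  - apply Cmod_mult_le.
    + rewrite Cmod_R, Rabs_pos_eq; fold h; lra.
    + apply Cmod_plus_le.
      * apply Cmod_mult_le; auto.
      * apply csum_le; intros k Hk.
        repeat (apply Cmod_mult_le || apply Cmod_plus_le);
          try (apply md_ule0; lia); try (apply md_vle0; lia).
        -- apply md_c0; lia.
        -- apply orbit_x_first_order; lia.
        -- apply orbit_y_first_order; lia.
  - right; field; lra.
Qed.

End Orbit.

(** * From orbit estimates to convergence on the sphere *)

(** The scalar [lam] cancels projectively: the numerator of [x / Y - z] is
    [(x - lam * z) - z * (Y - lam)], while [Y] stays at distance at least [1 / 2] from 0. *)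
Lemma quotient_close (x Y lam z : C) (e R0 : R) :
  Cmod lam = 1%R -> (Cmod z <= R0)%R -> (e <= 1 / 2)%R ->
  (Cmod (x - lam * z) <= e)%R -> (Cmod (Y - lam) <= e)%R ->
  Y <> 0 /\ (Cmod (x / Y - z) <= 2 * (1 + R0) * e)%R.
Proof.
  intros Hl Hz He Hx HY.
  assert (H2 : (1 / 2 <= Cmod Y)%R).
  { pose proof (Cmod_minus_le Y (Y - lam) _ _ (Rle_refl _) HY) as T.
    replace (Y - (Y - lam)) with lam in T by ring. lra. }
  assert (HY0 : Y <> 0) by (apply Cmod_gt_0; lra).
  split; auto.
  replace (x / Y - z) with (((x - lam * z) - z * (Y - lam)) / Y) by (field; auto).
  rewrite Cmod_div by auto.
  apply Rle_div_l; [lra |].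
  apply Rle_trans with (e + R0 * e)%R.
  - apply Cmod_minus_le; auto. apply Cmod_mult_le; auto.
  - assert (0 <= e)%R by (eapply Rle_trans; [apply Cmod_ge_0 | exact HY]).
    assert (0 <= R0)%R by (eapply Rle_trans; [apply Cmod_ge_0 | exact Hz]).
    assert (0 <= (1 + R0) * e)%R by (apply Rmult_le_pos; lra).
    nra.
Qed.

Lemma Cexp_neq_0 (z : C) : Cexp z <> 0.
Proof.
  intros H. apply (f_equal Cmod) in H. rewrite Cmod_0 in H.
  unfold Cmod, Cexp in H; cbn [fst snd] in H.
  apply sqrt_eq_0 in H; [| nra].
  pose proof (exp_pos (Re z)). pose proof (sin2_cos2 (Im z)) as T.
  unfold Rsqr in T.
  assert (exp (Re z) * exp (Re z) * (sin (Im z) * sin (Im z) + cos (Im z) * cos (Im z)) = 0)%R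
    by (rewrite <- H; ring).
  rewrite T in *; nra.
Qed.

(** Homogeneous coordinates [[X : Y]] on the sphere, with infinity at [Y = 0]; the pair [(0, 0)] is
    excluded in both branches. *)
Definition has_coords (s : option C) (X Y : C) : Prop :=
  match s with
  | Some w => Y <> 0 /\ X = w * Y
  | None => Y = 0 /\ X <> 0
  end.

(** The matrix [[[rho - ep^2, ep^2], [- 1, 1]]] has determinant [rho], which is nonzero, so it acts
    on homogeneous coordinates even at the pole and at infinity. *)
Lemma fmap_coords (th ep : C) (s : option C) (X Y : C) :
  has_coords s X Y ->
  has_coords (fmap th ep s)
    ((Cexp (2 * PI * Ci * th) - ep ^ 2) * X + ep ^ 2 * Y) (Y - X).
Proof.
  pose proof (Cexp_neq_0 (2 * PI * Ci * th)) as Hr.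
  unfold fmap. set (rho := Cexp _) in *.
  destruct s as [w |]; simpl has_coords at 1.
  - intros [HY ->].
    destruct (excluded_middle_informative (w = 1)) as [-> | Hw]; simpl.
    + split; [ring |]. intros E. apply (Cmult_neq_0 rho Y); auto.
      rewrite <- E; ring.
    + assert (1 - w <> 0).
      { intros E; apply Hw. replace w with (1 - (1 - w)) by ring. rewrite E; ring. }
      split.
      * replace (Y - w * Y) with ((1 - w) * Y) by ring. apply Cmult_neq_0; auto.
      * field; auto.
  - intros [-> HX]; simpl. split.
    + intros E; apply HX. replace X with (- (0 - X)) by ring. rewrite E; ring.
    + ring.
Qed.

Fixpoint orbit (N : nat) (theta eps : nat -> C) (z : C) (n : nat) : C * C :=
  match n with
  | O => (z, / INR N)
  | S m =>
      let x := fst (orbit N theta eps z m) in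
      let y := snd (orbit N theta eps z m) in
      ((Cexp (2 * PI * Ci * theta (S m)) - eps (S m) ^ 2) * x
         + INR N * eps (S m) ^ 2 * y,
       (- / INR N) * x + y)
  end.

Lemma fcomp_coords (N : nat) (theta eps : nat -> C) (z : C) (n : nat) :
  (0 < N)%nat ->
  has_coords (fcomp theta eps n (Some z))
    (fst (orbit N theta eps z n)) (INR N * snd (orbit N theta eps z n)).
Proof.
  intros HN.
  assert (HhC : RtoC (INR N) <> 0) by (apply RtoC_neq_0; apply not_0_INR; lia).
  induction n.
  - cbn -[INR]. replace (INR N * / INR N) with (RtoC 1) by (field; auto).
    split; [apply C1_nz | ring].
  - apply (fmap_coords (theta (S n)) (eps (S n))) in IHn.
    cbn [fcomp orbit fst snd].
    match goal with H : has_coords _ ?p ?q |- has_coords _ ?p' ?q' =>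
      replace p' with p by ring; replace q' with q by (field; auto) end.
    exact IHn.
Qed.

Lemma compact_bounded (S0 : C -> Prop) :
  compact_set S0 -> exists R0 : R, forall z, S0 z -> (Cmod z <= R0)%R.
Proof.
  intros HS.
  destruct (HS nat (fun n z => (Cmod z < INR n)%R)) as [l Hl].
  - intros n z Hz.
    assert (He : (0 < (INR n - Cmod z) / 2)%R) by lra.
    exists (mkposreal _ He); intros y Hy.
    (* Balls of [C] are those of the product uniform structure, hence the factor [sqrt 2] in the
       modulus; the radius was halved to absorb it. *)
    apply C_NormedModule_mixin_compat2 in Hy; simpl in Hy.
    assert (sqrt 2 <= 2)%R.
    { rewrite <- (sqrt_square 2) at 2 by lra. apply sqrt_le_1_alt; lra. }
    change (minus y z) with (Cminus y z) in Hy.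
    pose proof (Cmod_le_plus_dist y z) as T.
    assert (sqrt 2 * ((INR n - Cmod z) / 2) <= 2 * ((INR n - Cmod z) / 2))%R
      by (apply Rmult_le_compat_r; lra).
    lra.
  - intros z _. destruct (INR_unbounded (Cmod z)) as [n Hn]; exists n; lra.
  - exists (INR (list_max l)); intros z Hz.
    destruct (Hl z Hz) as (i & Hi & Hzi).
    assert (i <= list_max l)%nat.
    { pose proof (proj1 (list_max_le l (list_max l)) (le_n _)) as F.
      rewrite Forall_forall in F; auto. }
    apply Rle_trans with (INR i); [lra | apply le_INR; auto].
Qed.

(** Reduces convergence to exhibiting, for all large [N], a model whose constants [K], [M], [Q] do
    not depend on [N]. *)
Lemma cvg_of_model (theta eps : nat -> nat -> C) (K M Q : R) (N0 : nat) :
  (0 <= K)%R -> (0 <= M)%R ->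
  (forall N, (N0 <= N)%nat -> exists al be lam a b c d u v,
     model N (theta N) (eps N) K M Q al be lam a b c d u v) ->
  cvg_unif_on_compacts (fun N => fcomp (theta N) (eps N) N) (fun z => z).
Proof.
  intros HK HM H S0 HS e He.
  destruct (compact_bounded S0 HS) as [R1 HR1].
  (* The lower bound 1 lets [R0] dominate the initial second coordinate [1 / N] as well. *)
  set (R0 := Rmax 1 R1).
  assert (HR : (1 <= R0)%R) by apply Rmax_l.
  assert (HR0 : forall z, S0 z -> (Cmod z <= R0)%R).
  { intros z Hz. apply Rle_trans with R1; [auto | apply Rmax_r]. }
  set (D := (K + K * M * (8 * K * R0))%R).
  set (E := Rmax D (R0 * Q + 2 * K * M * D)).
  (* The bound [1 / 2] is what [quotient_close] asks for; the other makes its conclusion at most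
     [e / 2]. *)
  set (e' := Rmin (1 / 2) (e / (4 * (1 + R0)))).
  assert (He' : (0 < e')%R).
  { apply Rmin_pos; [lra |]. apply Rdiv_lt_0_compat; lra. }
  destruct (INR_unbounded (4 * K * M)) as [N1 HN1].
  destruct (INR_unbounded (E / e')) as [N2 HN2].
  exists (N0 + N1 + N2 + 1)%nat; intros N HN z Hz.
  assert (HNp : (0 < N)%nat) by lia.
  assert (Hh : (1 <= INR N)%R) by (apply (le_INR 1); lia).
  assert (HKM : (4 * K * M <= INR N)%R).
  { apply Rle_trans with (INR N1); [lra | apply le_INR; lia]. }
  assert (HE : (E / INR N <= e')%R).
  { apply Rle_div_l; [lra |]. apply Rlt_div_l in HN2; [| lra].
    apply Rle_trans with (INR N2 * e')%R; [lra |]. rewrite Rmult_comm.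
    apply Rmult_le_compat_l; [lra | apply le_INR; lia]. }
  destruct (H N) as (al & be & lam & a & b & c & d & u & v & Hm); [lia |].
  pose (x n := fst (orbit N (theta N) (eps N) z n)).
  pose (y n := snd (orbit N (theta N) (eps N) z n)).
  assert (HxS : forall n, x (S n) = (al + u n) * x n + (be + v n) * y n).
  { intros n; destruct Hm. rewrite md_u0, md_v0; reflexivity. }
  pose proof (orbit_x_end N (theta N) (eps N) K M Q al be lam a b c d u v x y z R0
    HNp Hm HK HM HR (HR0 z Hz) HKM eq_refl eq_refl HxS (fun n => eq_refl)) as Ex.
  pose proof (orbit_y_end N (theta N) (eps N) K M Q al be lam a b c d u v x y z R0
    HNp Hm HK HM HR (HR0 z Hz) HKM eq_refl eq_refl HxS (fun n => eq_refl)) as Ey.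
  assert (Hle : forall A, (A <= E)%R -> (A / INR N <= e')%R).
  { intros A HA. apply Rle_trans with (E / INR N)%R; auto.
    apply Rmult_le_compat_r; auto. left; apply Rinv_0_lt_compat; lra. }
  destruct (quotient_close (x N) (INR N * y N) lam z e' R0) as [HY Hq].
  - destruct Hm; auto.
  - auto.
  - apply Rmin_l.
  - eapply Rle_trans; [exact Ex |]. apply Hle, Rmax_l.
  - eapply Rle_trans; [exact Ey |]. apply Hle, Rmax_r.
  - pose proof (fcomp_coords N (theta N) (eps N) z N HNp) as F.
    fold (x N) (y N) in F.
    (* The value at infinity would force the second coordinate to vanish, against [HY]. *)
    destruct (fcomp (theta N) (eps N) N (Some z)) as [w |].
    + destruct F as [_ F]. exists w; split; [reflexivity |].
      replace (x N / (INR N * y N)) with w in Hq.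
      2: { rewrite F; field; split.
           - intros E0; apply HY; rewrite E0; ring.
           - intros E0; apply HY; rewrite E0; ring. }
      eapply Rle_lt_trans; [exact Hq |].
      assert (e' <= e / (4 * (1 + R0)))%R by apply Rmin_r.
      apply Rle_lt_trans with (2 * (1 + R0) * (e / (4 * (1 + R0))))%R.
      * apply Rmult_le_compat_l; lra.
      * replace (2 * (1 + R0) * (e / (4 * (1 + R0))))%R with (e / 2)%R by (field; lra).
        lra.
    + destruct F as [F _]; contradiction.
Qed.

(** * Order bounds and cancellation in weighted sums *)

Lemma div_pow_le (A h : R) (p q : nat) :
  (0 <= A)%R -> (1 <= h)%R -> (q <= p)%nat -> (A / h ^ p <= A / h ^ q)%R.
Proof.
  intros HA Hh Hpq. apply Rmult_le_compat_l; auto.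
  apply Rinv_le_contravar; [apply pow_lt; lra | apply Rle_pow; auto].
Qed.

Lemma bigO_inv_nonneg (D : nat -> nat -> Prop) (a : nat -> nat -> C) (p : nat) :
  bigO_inv D a p ->
  exists M : R, (0 <= M)%R /\ forall N k : nat, (0 < N)%nat -> D N k ->
    (Cmod (a N k) <= M / INR N ^ p)%R.
Proof.
  intros [M HM]. exists (Rabs M); split; [apply Rabs_pos |].
  intros N k HN HD. eapply Rle_trans; [apply HM, HD |].
  apply Rmult_le_compat_r; [| apply Rle_abs].
  left; apply Rinv_0_lt_compat, pow_lt, lt_0_INR; auto.
Qed.

(** In each pair of consecutive terms, either the sum of the two [e] or the difference of the two
    [g] supplies a factor [1 / N]. All pairs together cost at most [2 * (G * E)], and for odd [N]
    the unpaired last term costs one more [G * E]. *)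
Lemma csum_pairing (g e : nat -> C) (N : nat) (G E : R) :
  (0 < N)%nat ->
  (forall k, (k < N)%nat -> (Cmod (g k) <= G)%R) ->
  (forall k, (S k < N)%nat -> (Cmod (g (S k) - g k) <= G / INR N)%R) ->
  (forall k, (k < N)%nat -> (Cmod (e k) <= E)%R) ->
  (forall j, (S (2 * j) < N)%nat ->
     (Cmod (e (2 * j)%nat + e (S (2 * j))) <= E / INR N)%R) ->
  (Cmod (csum (fun k => (g k * e k)%C) N) <= 3 * (G * E))%R.
Proof.
  intros HN Hg Hdg He Hde.
  assert (Hh : (0 < INR N)%R) by (apply lt_0_INR; auto).
  assert (HG : (0 <= G)%R) by (eapply Rle_trans; [apply Cmod_ge_0 | apply (Hg O HN)]).
  assert (HE : (0 <= E)%R) by (eapply Rle_trans; [apply Cmod_ge_0 | apply (He O HN)]).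
  assert (HGE : (0 <= G * E)%R) by (apply Rmult_le_pos; auto).
  assert (Heven : forall m, (2 * m <= N)%nat ->
    (Cmod (csum (fun k => (g k * e k)%C) (2 * m)) <= INR m * (2 * (G * E) / INR N))%R).
  { induction m; intros Hm.
    - simpl; rewrite Cmod_0; lra.
    - replace (2 * S m)%nat with (S (S (2 * m))) by lia. cbn [csum].
      rewrite S_INR, Rmult_plus_distr_r, Rmult_1_l, <- Cplus_assoc.
      apply Cmod_plus_le; [apply IHm; lia |].
      replace (_ + _) with (g (2 * m)%nat * (e (2 * m)%nat + e (S (2 * m)))
        + (g (S (2 * m)) - g (2 * m)%nat) * e (S (2 * m))) by ring.
      replace (2 * (G * E) / INR N)%R with (G * (E / INR N) + G / INR N * E)%R
        by (field; lra).
      apply Cmod_plus_le; apply Cmod_mult_le;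
        (apply Hg || apply Hde || apply Hdg || apply He); lia. }
  assert (Hfac : forall m, (2 * m <= N)%nat ->
    (INR m * (2 * (G * E) / INR N) <= 2 * (G * E))%R).
  { intros m Hm. apply Rle_trans with (INR N * (2 * (G * E) / INR N))%R.
    - apply Rmult_le_compat_r; [apply Rdiv_le_0_compat; lra | apply le_INR; lia].
    - right; field; lra. }
  destruct (Nat.Even_or_Odd N) as [[m Hm] | [m Hm]].
  - pose proof (Heven m ltac:(lia)). pose proof (Hfac m ltac:(lia)).
    rewrite Hm at 1. lra.
  - pose proof (Heven m ltac:(lia)) as H1. pose proof (Hfac m ltac:(lia)).
    replace (csum (fun k => g k * e k) N)
      with (csum (fun k => g k * e k) (2 * m) + g (2 * m)%nat * e (2 * m)%nat).
    2: { replace N with (S (2 * m)) at 1 by lia. reflexivity. }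
    apply Rle_trans with (2 * (G * E) + G * E)%R; [| lra].
    apply Cmod_plus_le; [lra |].
    apply Cmod_mult_le; [apply Hg | apply He]; lia.
Qed.

(** Adding the sum to its reversal gives twice the sum, with terms in which either a reflected sum
    of [e] or a reflected difference of [g] is of order [1 / h]. The scale [h] is separate from the
    length [n] so that [n = N - 1] can be used with [h = N]. *)
Lemma csum_reflection (g e : nat -> C) (n : nat) (h G E : R) :
  (0 < h)%R -> (INR n <= h)%R ->
  (0 <= G)%R -> (0 <= E)%R ->
  (forall k, (k < n)%nat -> (Cmod (g k) <= G)%R) ->
  (forall k, (k < n)%nat -> (Cmod (g (n - 1 - k)%nat - g k) <= G / h)%R) ->
  (forall k, (k < n)%nat -> (Cmod (e k) <= E)%R) ->
  (forall k, (k < n)%nat -> (Cmod (e k + e (n - 1 - k)%nat) <= E / h)%R) ->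
  (Cmod (csum (fun k => (g k * e k)%C) n) <= G * E)%R.
Proof.
  intros Hh Hn HG HE Hg Hdg He Hde.
  assert (HGE : (0 <= G * E)%R) by (apply Rmult_le_pos; auto).
  set (T := csum (fun k => g k * e k) n).
  assert (E2 : 2 * T = csum (fun k => g k * (e k + e (n - 1 - k)%nat)
                 + (g (n - 1 - k)%nat - g k) * e (n - 1 - k)%nat) n).
  { replace (2 * T) with (T + T) by ring. unfold T at 2. rewrite csum_rev.
    unfold T. rewrite <- csum_plus. apply csum_ext; intros; ring. }
  assert (H2 : (Cmod (2 * T) <= 2 * (G * E))%R).
  { rewrite E2. apply Rle_trans with (INR n * (G * (E / h) + G / h * E))%R.
    - apply csum_le; intros k Hk.
      apply Cmod_plus_le; apply Cmod_mult_le;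
        (apply Hg || apply Hde || apply Hdg || apply He); lia.
    - apply Rle_trans with (h * (G * (E / h) + G / h * E))%R.
      + apply Rmult_le_compat_r; auto.
        replace (G * (E / h) + G / h * E)%R with (2 * (G * E) / h)%R by (field; lra).
        apply Rdiv_le_0_compat; lra.
      + right; field; lra. }
  rewrite Cmod_mult, Cmod_R, Rabs_pos_eq in H2; lra.
Qed.

(** * The complex exponential and its Taylor estimates *)

Lemma Cexp_plus (z w : C) : Cexp (z + w) = Cexp z * Cexp w.
Proof.
  destruct z as [x y], w as [x' y']. unfold Cexp, Cmult; cbn.
  rewrite exp_plus, cos_plus, sin_plus. f_equal; ring.
Qed.

Lemma Cexp_rot (t : R) :
  Cexp (2 * PI * Ci * t) = (cos (2 * PI * t), sin (2 * PI * t)).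
Proof.
  unfold Cexp. cbn.
  replace ((2 * PI - 0 * 0) * 0 - (2 * 0 + 0 * PI) * 1)%R with 0%R by ring.
  match goal with |- ((exp ?p * cos ?q)%R, _) = _ =>
    replace p with 0%R by ring; replace q with (2 * PI * t)%R by ring end.
  rewrite exp_0, !Rmult_1_l. reflexivity.
Qed.

Lemma Cmod_rot (t : R) : Cmod (Cexp (2 * PI * Ci * t)) = 1%R.
Proof.
  rewrite Cexp_rot. unfold Cmod; cbn [fst snd].
  rewrite <- !Rsqr_pow2, Rplus_comm, sin2_cos2. apply sqrt_1.
Qed.

Lemma cos_taylor (y : R) :
  (Rabs y <= 2)%R -> (1 - y ^ 2 / 2 <= cos y <= 1 - y ^ 2 / 2 + y ^ 4 / 24)%R.
Proof.
  intros H. apply Rabs_le_between in H.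
  destruct (pre_cos_bound y 0) as [H1 H2]; try lra.
  unfold cos_approx, cos_term in H1, H2. simpl in H1, H2. lra.
Qed.

Lemma sin_taylor (y : R) :
  (0 <= y <= 4)%R -> (y - y ^ 3 / 6 <= sin y <= y)%R.
Proof.
  intros H. destruct (pre_sin_bound y 0) as [H1 _]; try lra.
  unfold sin_approx, sin_term in H1. simpl in H1. split; [lra |].
  destruct (Req_dec y 0) as [-> | Hy]; [rewrite sin_0; lra |].
  left; apply sin_lt_x; lra.
Qed.

Lemma sin_sub_le (y : R) : (Rabs y <= 1 / 2)%R -> (Rabs (sin y - y) <= y ^ 2)%R.
Proof.
  assert (P : forall t, (0 <= t <= 1 / 2 -> Rabs (sin t - t) <= t ^ 2)%R).
  { intros t Ht. destruct (sin_taylor t ltac:(lra)).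
    apply Rabs_le; split; [| nra].
    assert (0 <= t * t)%R by nra. nra. }
  intros H. apply Rabs_le_between in H. destruct (Rle_dec 0 y).
  - apply P; lra.
  - replace (sin y - y)%R with (- (sin (- y) - (- y)))%R by (rewrite sin_neg; ring).
    rewrite Rabs_Ropp. replace (y ^ 2)%R with ((- y) ^ 2)%R by ring. apply P; lra.
Qed.

(** The upper bound comes from [exp (- x) >= 1 - x], that is [exp x <= 1 / (1 - x)], and from
    [(1 + x + 2 * x ^ 2) * (1 - x) >= 1] for [x <= 1 / 2]. *)
Lemma exp_sub_le (x : R) : (Rabs x <= 1 / 2)%R -> (0 <= exp x - 1 - x <= 2 * x ^ 2)%R.
Proof.
  intros H. apply Rabs_le_between in H.
  split; [pose proof (exp_ineq1_le x); lra |].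
  pose proof (exp_ineq1_le (- x)) as H1.
  pose proof (exp_pos x) as Hp.
  assert (E : (exp x * exp (- x) = 1)%R) by (rewrite <- exp_plus, Rplus_opp_r; apply exp_0).
  assert (H2 : (exp x * (1 + - x) <= 1)%R) by (rewrite <- E; apply Rmult_le_compat_l; lra).
  assert (1 <= (1 + x + 2 * x ^ 2) * (1 - x))%R by nra.
  nra.
Qed.

Lemma Cmod_le_re_im (z : C) : (Cmod z <= Rabs (Re z) + Rabs (Im z))%R.
Proof.
  replace z with (RtoC (Re z) + Ci * RtoC (Im z)) at 1.
  - apply Cmod_plus_le; [rewrite Cmod_R; lra |].
    rewrite Cmod_mult, Cmod_Ci, Cmod_R; lra.
  - destruct z; unfold Cplus, Cmult; cbn; f_equal; ring.
Qed.

Lemma Cexp_taylor (z : C) :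
  (Cmod z <= 1 / 2)%R -> (Cmod (Cexp z - 1 - z) <= 4 * Cmod z ^ 2)%R.
Proof.
  intros H. rewrite Cmod2_alt.
  pose proof (Rmax_Cmod z) as Hmax.
  set (x := Re z). set (y := Im z).
  assert (Hx : (Rabs x <= 1 / 2)%R).
  { eapply Rle_trans; [apply Rmax_l | eapply Rle_trans; [exact Hmax | auto]]. }
  assert (Hy : (Rabs y <= 1 / 2)%R).
  { eapply Rle_trans; [apply Rmax_r | eapply Rle_trans; [exact Hmax | auto]]. }
  eapply Rle_trans; [apply Cmod_le_re_im |].
  replace (Re (Cexp z - 1 - z)) with (exp x * (cos y - 1) + (exp x - 1 - x))%R
    by (unfold x, y, Cexp; destruct z; cbn; ring).
  replace (Im (Cexp z - 1 - z)) with ((exp x - 1) * sin y + (sin y - y))%R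
    by (unfold x, y, Cexp; destruct z; cbn; ring).
  pose proof (exp_sub_le x Hx) as He.
  pose proof (sin_sub_le y Hy) as Hs.
  pose proof (cos_taylor y ltac:(lra)) as Hc.
  pose proof (COS_bound y) as Hc1.
  pose proof (Rabs_pos x). pose proof (Rabs_pos y).
  assert (Hx2 : (x ^ 2 = Rabs x ^ 2)%R) by (symmetry; apply pow2_abs).
  assert (Hy2 : (y ^ 2 = Rabs y ^ 2)%R) by (symmetry; apply pow2_abs).
  pose proof (proj1 (Rabs_le_between _ _) Hx).
  assert (He2 : (0 < exp x <= 2)%R) by (split; [apply exp_pos | nra]).
  assert (Hre : (Rabs (exp x * (cos y - 1) + (exp x - 1 - x)) <= y ^ 2 + 2 * x ^ 2)%R).
  { apply Rabs_le; split; nra. }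
  assert (Hsy : (Rabs (sin y) <= 2 * Rabs y)%R).
  { replace (sin y) with (y + (sin y - y))%R by ring.
    eapply Rle_trans; [apply Rabs_triang | nra]. }
  assert (Hex : (Rabs (exp x - 1) <= 2 * Rabs x)%R).
  { replace (exp x - 1)%R with (x + (exp x - 1 - x))%R by ring.
    eapply Rle_trans; [apply Rabs_triang |]. rewrite (Rabs_pos_eq (exp x - 1 - x)) by lra.
    nra. }
  assert (Him : (Rabs ((exp x - 1) * sin y + (sin y - y)) <= 4 * (Rabs x * Rabs y) + y ^ 2)%R).
  { eapply Rle_trans; [apply Rabs_triang |]. rewrite Rabs_mult.
    assert (Rabs (exp x - 1) * Rabs (sin y) <= (2 * Rabs x) * (2 * Rabs y))%R
      by (apply Rmult_le_compat; auto using Rabs_pos). lra. }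
  assert (2 * (Rabs x * Rabs y) <= x ^ 2 + y ^ 2)%R
    by (rewrite Hx2, Hy2; pose proof (pow2_ge_0 (Rabs x - Rabs y)); lra).
  lra.
Qed.

(** * The rotation reference matrix, for cases (1)-(3) *)

Definition rotN (N : nat) : C := Cexp (2 * PI * Ci * (1 / INR N)).

Definition geo (z : C) (n : nat) : C := csum (fun j => z ^ j) n.

(** The lower left entry of the [n]-th power of [[[r, 0], [- 1 / N, 1]]] with [r = rotN N]. *)
Definition rot_c (N n : nat) : C := - / INR N * geo (rotN N) n.

Lemma geo_mult (z : C) (n : nat) : (z - 1) * geo z n = z ^ n - 1.
Proof.
  unfold geo. induction n; simpl; [ring |].
  rewrite Cmult_plus_distr_l, IHn; ring.
Qed.

Lemma geo_root (z : C) (n : nat) : z <> 1 -> z ^ n = 1 -> geo z n = 0.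
Proof.
  intros Hz Hn. pose proof (geo_mult z n) as E. rewrite Hn in E.
  destruct (Ceq_dec (geo z n) 0) as [| Hg]; auto.
  exfalso. apply (Cmult_neq_0 (z - 1) (geo z n)); auto.
  - intros E1; apply Hz. replace z with (z - 1 + 1) by ring. rewrite E1; ring.
  - rewrite E; ring.
Qed.

Lemma Cmod_geo_le (z : C) (n : nat) : Cmod z = 1%R -> (Cmod (geo z n) <= INR n)%R.
Proof.
  intros Hz. rewrite <- (Rmult_1_r (INR n)). apply csum_le; intros.
  rewrite Cmod_pow, Hz, pow1; lra.
Qed.

Section RootOfUnity.

Variable N : nat.
Hypothesis HN : (0 < N)%nat.

Lemma inv_N_RtoC : 1 / INR N = RtoC (/ INR N).
Proof.
  rewrite RtoC_inv; [unfold Cdiv; ring |]. pose proof (INR_ge_1 N HN); lra.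
Qed.

Lemma rotN_eq : rotN N = (cos (2 * PI * / INR N), sin (2 * PI * / INR N)).
Proof. unfold rotN. rewrite inv_N_RtoC. apply Cexp_rot. Qed.

Lemma Cmod_rotN : Cmod (rotN N) = 1%R.
Proof. unfold rotN. rewrite inv_N_RtoC. apply Cmod_rot. Qed.

Lemma Cexp_rotN_pow (k : nat) : Cexp (2 * PI * Ci * INR k / INR N) = rotN N ^ k.
Proof.
  pose proof (INR_C_neq_0 N HN) as H.
  induction k.
  - replace (2 * PI * Ci * INR 0 / INR N) with (2 * PI * Ci * RtoC 0)
      by (simpl; field; auto).
    rewrite Cexp_rot, Rmult_0_r, cos_0, sin_0. reflexivity.
  - rewrite Cpow_S, <- IHk. unfold rotN. rewrite <- Cexp_plus. f_equal.
    rewrite S_INR, RtoC_plus. field; auto.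
Qed.

Lemma rotN_pow_N : rotN N ^ N = 1.
Proof.
  rewrite <- Cexp_rotN_pow.
  replace (2 * PI * Ci * INR N / INR N) with (2 * PI * Ci * RtoC 1)
    by (field; apply INR_C_neq_0, HN).
  rewrite Cexp_rot, Rmult_1_r, cos_2PI, sin_2PI. reflexivity.
Qed.

(** From [N = 3] on, the angle [2 * PI / N] lies strictly between 0 and [PI], so its sine is
    positive. Both facts make geometric sums over [N] terms vanish. *)
Lemma rotN_neq : (3 <= N)%nat -> rotN N <> 1 /\ rotN N ^ 2 <> 1.
Proof.
  intros H3.
  assert (Hh : (3 <= INR N)%R) by (replace 3%R with (INR 3) by (simpl; ring); apply le_INR; auto).
  pose proof PI_RGT_0.
  assert (Hs : (0 < sin (2 * PI * / INR N))%R).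
  { apply sin_gt_0.
    - apply Rmult_lt_0_compat; [lra | apply Rinv_0_lt_compat; lra].
    - apply Rlt_div_l; nra. }
  rewrite rotN_eq. split.
  - intros E. apply (f_equal Im) in E. cbn in E. lra.
  - intros E.
    set (c := cos (2 * PI * / INR N)) in *. set (s := sin (2 * PI * / INR N)) in *.
    assert (E1 : (c * c - s * s = 1)%R).
    { apply (f_equal Re) in E. cbn in E. lra. }
    assert (E2 : (s * s + c * c = 1)%R) by apply sin2_cos2.
    nra.
Qed.

Lemma Cmod_rot_c_le (n : nat) : (n <= N)%nat -> (Cmod (rot_c N n) <= 1)%R.
Proof.
  intros Hn. pose proof (INR_ge_1 N HN). unfold rot_c.
  replace 1%R with (/ INR N * INR N)%R by (field; lra).
  apply Cmod_mult_le.
  - rewrite Cmod_opp, (Cmod_inv_INR N HN); lra.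
  - eapply Rle_trans; [apply Cmod_geo_le, Cmod_rotN | apply le_INR; auto].
Qed.

Lemma rot_c_S (n : nat) : rot_c N (S n) = - / INR N * rotN N ^ n + rot_c N n.
Proof. unfold rot_c, geo; cbn [csum]; ring. Qed.

Lemma Cmod_rotN_pow (n : nat) : Cmod (rotN N ^ n) = 1%R.
Proof. rewrite Cmod_pow, Cmod_rotN; apply pow1. Qed.

Lemma Cmod_2PI_Ci (z : C) : (Cmod (2 * PI * Ci * z) <= 8 * Cmod z)%R.
Proof.
  rewrite !Cmod_mult, Cmod_Ci, !Cmod_R.
  pose proof PI_RGT_0. pose proof PI_4.
  rewrite !Rabs_pos_eq by lra. pose proof (Cmod_ge_0 z). nra.
Qed.

Lemma Cmod_rotN_sub_1 : (16 <= N)%nat -> (Cmod (rotN N - 1) <= 24 / INR N)%R.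
Proof.
  intros H16.
  assert (Hh : (16 <= INR N)%R) by (replace 16%R with (INR 16) by (simpl; ring); apply le_INR; auto).
  set (z := 2 * PI * Ci * (1 / INR N)).
  assert (Hz : (Cmod z <= 8 * / INR N)%R).
  { eapply Rle_trans; [apply Cmod_2PI_Ci |]. rewrite inv_N_RtoC, Cmod_R, Rabs_pos_eq; [lra |].
    left; apply Rinv_0_lt_compat; lra. }
  assert (Hi : (/ INR N <= / 16)%R) by (apply Rinv_le_contravar; lra).
  (* With [N >= 16], [Cmod z <= 8 / N <= 1 / 2], and the quadratic error [256 / N ^ 2] is at most
     [16 / N]; hence [24 = 8 + 16]. *)
  pose proof (Cexp_taylor z ltac:(lra)) as T.
  pose proof (Cmod_ge_0 z).
  change (rotN N) with (Cexp z).
  replace (Cexp z - 1) with (z + (Cexp z - 1 - z)) by ring.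
  eapply Rle_trans; [apply Cmod_triangle |].
  unfold Rdiv. nra.
Qed.

(** Discrete product rule: the step in the power of [rotN N] costs [24 / N], the step in [rot_c]
    costs [1 / N]. This is the slow variation required by [csum_pairing]. *)
Lemma rot_weight_variation (k : nat) :
  (16 <= N)%nat -> (S k < N)%nat ->
  (Cmod (rot_c N (N - 1 - S k) * rotN N ^ S k - rot_c N (N - 1 - k) * rotN N ^ k)
   <= 25 / INR N)%R.
Proof.
  intros H16 Hk.
  replace (N - 1 - k)%nat with (S (N - 1 - S k)) by lia.
  set (n := (N - 1 - S k)%nat).
  replace (_ - _) with (rot_c N n * ((rotN N - 1) * rotN N ^ k)
    + / INR N * (rotN N ^ n * rotN N ^ k)) by (rewrite rot_c_S; simpl; ring).
  replace (25 / INR N)%R with (1 * (24 / INR N * 1) + / INR N * (1 * 1))%R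
    by (pose proof (INR_ge_1 N HN); field; lra).
  repeat (apply Cmod_plus_le || apply Cmod_mult_le);
    rewrite ?Cmod_rotN_pow, ?(Cmod_inv_INR N HN); try apply Rle_refl.
  - apply Cmod_rot_c_le; lia.
  - apply Cmod_rotN_sub_1; auto.
Qed.

(** Multiplication by [r - 1] telescopes the geometric sum inside [rot_c]; with [r ^ N = 1] the
    total becomes a combination of the full geometric sums of [r] and [r ^ 2], and both are zero. *)
Lemma rot_resonant_sum :
  (3 <= N)%nat ->
  csum (fun k => rot_c N (N - 1 - k) * rotN N ^ k * rotN N ^ S k) N = 0.
Proof.
  intros H3. destruct (rotN_neq H3) as [Hr Hr2].
  set (r := rotN N) in *.
  set (T := csum _ N).
  assert (E : (r - 1) * T = 0).
  { unfold T. rewrite <- csum_scal.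
    rewrite (csum_ext _ (fun k => (- / INR N) * (r ^ k) + (/ INR N * r) * (r ^ 2) ^ k)).
    - rewrite (csum_plus (fun k => - / INR N * r ^ k)), (csum_scal _ (fun k => r ^ k)),
        (csum_scal _ (fun k => (r ^ 2) ^ k)).
      change (- / INR N * geo r N + / INR N * r * geo (r ^ 2) N = 0).
      rewrite !geo_root; auto; [ring | | apply rotN_pow_N].
      rewrite <- Cpow_mult_r, Nat.mul_comm, Cpow_mult_r.
      unfold r; rewrite rotN_pow_N. apply Cpow_1_l.
    - intros k Hk.
      transitivity (- / INR N * ((r - 1) * geo r (N - 1 - k)) * r ^ k * r ^ S k).
      { unfold rot_c; fold r; ring. }
      rewrite geo_mult.
      transitivity (- / INR N * (r ^ N * r ^ k) + / INR N * (r ^ S k * r ^ k)).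
      { replace (r ^ N) with (r ^ (N - 1 - k) * r ^ S k)
          by (rewrite <- Cpow_add_r; f_equal; lia). ring. }
      unfold r at 1; rewrite rotN_pow_N; fold r.
      rewrite <- Cpow_mult_r. replace (2 * k)%nat with (k + k)%nat by lia.
      rewrite Cpow_add_r. simpl. ring. }
  destruct (Ceq_dec T 0) as [| HT]; auto.
  exfalso. apply (Cmult_neq_0 (r - 1) T); auto.
  intros E1; apply Hr. replace r with (r - 1 + 1) by ring. rewrite E1; ring.
Qed.

End RootOfUnity.

(** Common reduction of cases (1)-(3): all that remains is the bound on the weighted sum of the
    deviations of [theta] from [1 / N]. *)
Lemma cvg_rotation (theta eps : nat -> nat -> C) (M1 Q1 : R) (N0 : nat) :
  (0 <= M1)%R -> bigO_inv in_range eps 2 ->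
  (forall N k, (N0 <= N)%nat -> (k < N)%nat ->
     (Cmod (theta N (S k) - 1 / INR N) <= M1 / INR N ^ 2)%R) ->
  (forall N, (N0 <= N)%nat ->
     (Cmod (csum (fun k => rot_c N (N - 1 - k) * rotN N ^ k
                           * (theta N (S k) - 1 / INR N))%C N)
      <= Q1 / INR N ^ 2)%R) ->
  cvg_unif_on_compacts (fun N => fcomp (theta N) (eps N) N) (fun z => z).
Proof.
  intros HM1 He Ht HQ.
  destruct (bigO_inv_nonneg _ _ _ He) as (Me & HMe & Heps).
  (* Beyond [N1] the exponents [zeta k] below have modulus at most [1 / 2], as [Cexp_taylor]
     demands. *)
  destruct (INR_unbounded (16 * M1)) as [N1 HN1].
  apply (cvg_of_model theta eps 1 (8 * M1 + 256 * M1 ^ 2 + Me ^ 2)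
    (8 * Q1 + (256 * M1 ^ 2 + 2 * Me ^ 2)) (N0 + N1 + 3)); [lra | nra |].
  intros N HN.
  assert (HNp : (0 < N)%nat) by lia.
  pose proof (INR_ge_1 N HNp) as Hh.
  pose proof (INR_C_neq_0 N HNp) as HhC.
  set (h := INR N) in *.
  set (r := rotN N).
  set (delta k := theta N (S k) - 1 / INR N).
  set (zeta k := 2 * PI * Ci * delta k).
  (* Since [rho = r * Cexp (zeta k)], the deviation of the upper left entry is [r * zeta k] plus
     this remainder, which is of order [1 / N ^ 4]. *)
  set (rem k := r * (Cexp (zeta k) - 1 - zeta k) - eps N (S k) ^ 2).
  set (u k := r * zeta k + rem k).
  set (v k := INR N * eps N (S k) ^ 2).
  assert (Hr : Cmod r = 1%R) by (apply Cmod_rotN; auto).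
  assert (Hdelta : forall k, (k < N)%nat -> (Cmod (delta k) <= M1 / h ^ 2)%R).
  { intros k Hk; apply Ht; auto; lia. }
  assert (Hzeta : forall k, (k < N)%nat -> (Cmod (zeta k) <= 8 * M1 / h ^ 2)%R).
  { intros k Hk. eapply Rle_trans; [apply Cmod_2PI_Ci |].
    pose proof (Hdelta k Hk). lra. }
  assert (Hzeta2 : (8 * M1 / h ^ 2 <= 1 / 2)%R).
  { apply Rle_div_l; [apply pow_lt; lra |].
    assert (16 * M1 <= h)%R by (apply Rle_trans with (INR N1); [lra | apply le_INR; lia]).
    nra. }
  assert (Heps2 : forall k, (k < N)%nat -> (Cmod (eps N (S k) ^ 2) <= Me ^ 2 / h ^ 4)%R).
  { intros k Hk. rewrite Cmod_pow.
    replace (Me ^ 2 / h ^ 4)%R with ((Me / h ^ 2) ^ 2)%R by (field; lra).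
    apply pow_incr; split; [apply Cmod_ge_0 |]. apply Heps; auto. split; lia. }
  assert (Hrem : forall k, (k < N)%nat -> (Cmod (rem k) <= (256 * M1 ^ 2 + Me ^ 2) / h ^ 4)%R).
  { intros k Hk. unfold rem.
    replace ((256 * M1 ^ 2 + Me ^ 2) / h ^ 4)%R
      with (1 * (4 * (8 * M1 / h ^ 2) ^ 2) + Me ^ 2 / h ^ 4)%R by (field; lra).
    apply Cmod_minus_le; [apply Cmod_mult_le; [lra |] | auto].
    pose proof (Hzeta k Hk) as Hz.
    eapply Rle_trans; [apply Cexp_taylor; lra |].
    apply Rmult_le_compat_l; [lra |].
    apply pow_incr; split; [apply Cmod_ge_0 | auto]. }
  assert (Hv : forall k, (k < N)%nat -> (Cmod (v k) <= Me ^ 2 / h ^ 3)%R).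
  { intros k Hk. unfold v.
    replace (Me ^ 2 / h ^ 3)%R with (h * (Me ^ 2 / h ^ 4))%R by (field; lra).
    apply Cmod_mult_le; auto. rewrite Cmod_R, Rabs_pos_eq; fold h; lra. }
  assert (P1 : (0 <= 256 * M1 ^ 2 + Me ^ 2)%R) by nra.
  assert (P2 : (0 <= Me ^ 2)%R) by nra.
  exists r, 0, 1, (fun n => r ^ n), (fun _ => 0), (rot_c N), (fun _ => 1), u, v.
  split.
  - reflexivity.
  - reflexivity.
  - unfold rot_c, geo; simpl; ring.
  - reflexivity.
  - intros n; simpl; ring.
  - intros n; ring.
  - apply rot_c_S.
  - intros n; ring.
  - intros k. replace (2 * PI * Ci * theta N (S k))
      with (2 * PI * Ci * (1 / INR N) + zeta k) by (unfold zeta, delta; ring).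
    rewrite Cexp_plus. fold (rotN N); fold r. unfold u, rem. ring.
  - intros k; unfold v; ring.
  - intros n _. rewrite Cmod_pow, Hr, pow1; lra.
  - intros n _. rewrite Cmod_0; lra.
  - apply Cmod_rot_c_le; auto.
  - intros n _. rewrite Cmod_1; lra.
  - intros k Hk. fold h.
    apply Rle_trans with (1 * (8 * M1 / h ^ 2) + (256 * M1 ^ 2 + Me ^ 2) / h ^ 2)%R.
    + apply Cmod_plus_le; [apply Cmod_mult_le; [lra | auto] |].
      eapply Rle_trans; [apply Hrem; auto |]. apply div_pow_le; auto; lia.
    + right; field; lra.
  - intros k Hk. fold h. eapply Rle_trans; [apply Hv; auto |].
    eapply Rle_trans; [apply (div_pow_le _ h 3 2); auto; lia |].
    apply Rmult_le_compat_r; [left; apply Rinv_0_lt_compat, pow_lt; lra | nra].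
  - apply rotN_pow_N; auto.
  - reflexivity.
  - unfold rot_c. fold r.
    rewrite geo_root; [ring | | apply rotN_pow_N; auto].
    apply rotN_neq; auto; lia.
  - reflexivity.
  - apply Cmod_1.
  - set (c := rot_c N).
    (* The part linear in [delta] is the sum controlled by [HQ]; every other term is of order
       [1 / N ^ 3] and is bounded individually. *)
    rewrite (csum_ext _ (fun k => (2 * PI * Ci * r) * (c (N - 1 - k)%nat * r ^ k * delta k)
      + c (N - 1 - k)%nat * (rem k * r ^ k + v k * c k)))
      by (intros k Hk; unfold u, zeta; ring).
    rewrite csum_plus, csum_scal. fold h.
    replace ((8 * Q1 + (256 * M1 ^ 2 + 2 * Me ^ 2)) / h ^ 2)%R
      with (8 * (Q1 / h ^ 2) + h * ((256 * M1 ^ 2 + 2 * Me ^ 2) / h ^ 3))%R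
      by (field; lra).
    apply Cmod_plus_le.
    + apply Cmod_mult_le.
      * eapply Rle_trans; [apply Cmod_2PI_Ci | lra].
      * apply HQ; lia.
    + apply csum_le; intros k Hk.
      apply Rle_trans with (1 * ((256 * M1 ^ 2 + Me ^ 2) / h ^ 3 * 1 + Me ^ 2 / h ^ 3 * 1))%R.
      * apply Cmod_mult_le; [apply Cmod_rot_c_le; auto; lia |].
        apply Cmod_plus_le; apply Cmod_mult_le; auto.
        -- eapply Rle_trans; [apply Hrem; auto |]. apply div_pow_le; auto; lia.
        -- rewrite Cmod_pow, Hr, pow1; lra.
        -- apply Cmod_rot_c_le; auto; lia.
      * right; field; lra.
Qed.

(** * The trigonometric reference matrix, for cases (4)-(5) *)

(* Closed form of the n-th power [[a, b], [c, d]] of the reference matrix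
   [[2 cos phi - 1, N (2 - 2 cos phi)], [- 1 / N, 1]]; par_t is tan (phi / 2). *)
Definition par_phi (N : nat) : R := (PI / INR N)%R.
Definition par_t (N : nat) : R := ((1 - cos (par_phi N)) / sin (par_phi N))%R.
Definition par_a (N n : nat) : R :=
  (cos (INR n * par_phi N) - par_t N * sin (INR n * par_phi N))%R.
Definition par_b (N n : nat) : R := (2 * INR N * par_t N * sin (INR n * par_phi N))%R.
Definition par_c (N n : nat) : R :=
  (- / (INR N * sin (par_phi N)) * sin (INR n * par_phi N))%R.
Definition par_d (N n : nat) : R :=
  (cos (INR n * par_phi N) + par_t N * sin (INR n * par_phi N))%R.

Section Parabolic.

Variable N : nat.
Hypothesis HN : (4 <= N)%nat.

Local Notation h := (INR N).
Local Notation phi := (par_phi N).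

Lemma par_h : (4 <= h)%R.
Proof. replace 4%R with (INR 4) by (simpl; ring). apply le_INR; auto. Qed.

Lemma par_phi_bounds : (0 < phi <= 1)%R.
Proof.
  pose proof par_h. pose proof PI_RGT_0. pose proof PI_4. unfold par_phi. split.
  - apply Rdiv_lt_0_compat; lra.
  - apply Rle_div_l; lra.
Qed.

Lemma par_h_phi : (h * phi = PI)%R.
Proof. pose proof par_h. unfold par_phi; field; lra. Qed.

Lemma par_sin_ge : (phi / 2 <= sin phi)%R.
Proof.
  pose proof par_phi_bounds. destruct (sin_taylor phi ltac:(lra)) as [H1 _].
  assert (phi ^ 3 <= phi)%R by nra. lra.
Qed.

Lemma par_sin_pos : (0 < sin phi)%R.
Proof. pose proof par_sin_ge. pose proof par_phi_bounds. lra. Qed.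

Lemma par_t_bounds : (0 <= par_t N <= phi)%R.
Proof.
  pose proof par_sin_ge. pose proof par_sin_pos. pose proof par_phi_bounds.
  pose proof (cos_taylor phi ltac:(rewrite Rabs_pos_eq; lra)).
  pose proof (COS_bound phi). unfold par_t. split.
  - apply Rdiv_le_0_compat; lra.
  - apply Rle_div_l; nra.
Qed.

Lemma par_cosS (n : nat) :
  cos (INR (S n) * phi) =
  (cos (INR n * phi) * cos phi - sin (INR n * phi) * sin phi)%R.
Proof. rewrite S_INR, Rmult_plus_distr_r, Rmult_1_l. apply cos_plus. Qed.

Lemma par_sinS (n : nat) :
  sin (INR (S n) * phi) =
  (sin (INR n * phi) * cos phi + cos (INR n * phi) * sin phi)%R.
Proof. rewrite S_INR, Rmult_plus_distr_r, Rmult_1_l. apply sin_plus. Qed.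

(** Each recurrence, after the addition formulas and clearing of denominators, is a polynomial
    identity modulo [sin phi ^ 2 = 1 - cos phi ^ 2]. *)
Ltac par_solve :=
  pose proof par_h; pose proof par_sin_pos;
  let E := fresh in
  assert (E : (sin phi ^ 2 = 1 - cos phi ^ 2)%R)
    by (pose proof (sin2_cos2 phi) as E; unfold Rsqr in E; lra);
  unfold par_a, par_b, par_c, par_d, par_t; rewrite ?par_cosS, ?par_sinS;
  field_simplify_eq; [| lra ..];
  rewrite ?E; ring.

Lemma par_aS (n : nat) : (par_a N (S n) =
  (2 * cos phi - 1) * par_a N n + h * (2 - 2 * cos phi) * par_c N n)%R.
Proof. par_solve. Qed.

Lemma par_bS (n : nat) : (par_b N (S n) =
  (2 * cos phi - 1) * par_b N n + h * (2 - 2 * cos phi) * par_d N n)%R.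
Proof. par_solve. Qed.

Lemma par_cS (n : nat) : (par_c N (S n) = - / h * par_a N n + par_c N n)%R.
Proof. par_solve. Qed.

Lemma par_dS (n : nat) : (par_d N (S n) = - / h * par_b N n + par_d N n)%R.
Proof. par_solve. Qed.

Lemma par_a_le (n : nat) : (Rabs (par_a N n) <= 8)%R.
Proof.
  pose proof par_t_bounds. pose proof par_phi_bounds.
  pose proof (COS_bound (INR n * phi)). pose proof (SIN_bound (INR n * phi)).
  unfold par_a. apply Rabs_le; split; nra.
Qed.

Lemma par_d_le (n : nat) : (Rabs (par_d N n) <= 8)%R.
Proof.
  pose proof par_t_bounds. pose proof par_phi_bounds.
  pose proof (COS_bound (INR n * phi)). pose proof (SIN_bound (INR n * phi)).
  unfold par_d. apply Rabs_le; split; nra.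
Qed.

(** The factor [N] is compensated by [par_t N <= phi = PI / N], which leaves [2 * PI <= 8]. *)
Lemma par_b_le (n : nat) : (Rabs (par_b N n) <= 8)%R.
Proof.
  pose proof par_t_bounds. pose proof par_h. pose proof par_h_phi. pose proof PI_4.
  pose proof (SIN_bound (INR n * phi)).
  assert (0 <= 2 * h * par_t N <= 8)%R by nra.
  unfold par_b. apply Rabs_le; split; nra.
Qed.

(** The denominator is bounded below: [h * sin phi >= h * phi / 2 = PI / 2 > 1]. *)
Lemma par_c_le (n : nat) : (Rabs (par_c N n) <= 8)%R.
Proof.
  pose proof par_h. pose proof par_h_phi. pose proof PI2_1. pose proof par_sin_ge.
  pose proof (SIN_bound (INR n * phi)).
  assert (Hs1 : (1 <= h * sin phi)%R) by nra.
  assert (Hs2 : (0 < / (h * sin phi) <= 1)%R).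
  { split; [apply Rinv_0_lt_compat; lra |]. rewrite <- Rinv_1.
    apply Rinv_le_contravar; lra. }
  unfold par_c. apply Rabs_le; split; nra.
Qed.

Lemma par_end :
  par_a N N = (-1)%R /\ par_b N N = 0%R /\ par_c N N = 0%R /\ par_d N N = (-1)%R.
Proof.
  unfold par_a, par_b, par_c, par_d. rewrite par_h_phi, cos_PI, sin_PI.
  repeat split; ring.
Qed.

Lemma par_init :
  par_a N O = 1%R /\ par_b N O = 0%R /\ par_c N O = 0%R /\ par_d N O = 1%R.
Proof.
  unfold par_a, par_b, par_c, par_d. simpl INR. rewrite Rmult_0_l, cos_0, sin_0.
  repeat split; ring.
Qed.

Lemma par_c_step (n : nat) : (Rabs (par_c N (S n) - par_c N n) <= 8 / h)%R.
Proof.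
  pose proof par_h. rewrite par_cS.
  replace (_ - _)%R with (- (par_a N n / h))%R by (field; lra).
  rewrite Rabs_Ropp, Rabs_div by lra. rewrite (Rabs_pos_eq h) by lra.
  apply Rmult_le_compat_r; [left; apply Rinv_0_lt_compat; lra | apply par_a_le].
Qed.

Lemma par_weight_le (k : nat) :
  (Cmod (RtoC (par_c N (N - 1 - k)) * RtoC (par_c N k)) <= 64)%R.
Proof.
  replace 64%R with (8 * 8)%R by ring.
  apply Cmod_mult_le; rewrite Cmod_R; apply par_c_le.
Qed.

(** The reflection of [k] within the first [N - 1] indices is [n = N - 2 - k], and it changes the
    weight from [c (n + 1) * c k] to [c (k + 1) * c n]. Each factor moves by a single step, which
    [par_c_step] bounds. *)
Lemma par_weight_reflection (k : nat) :
  (k < N - 1)%nat ->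
  (Cmod (RtoC (par_c N (N - 1 - (N - 1 - 1 - k))) * RtoC (par_c N (N - 1 - 1 - k))
         - RtoC (par_c N (N - 1 - k)) * RtoC (par_c N k)) <= 128 / h)%R.
Proof.
  intros Hk. pose proof par_h.
  replace (N - 1 - (N - 1 - 1 - k))%nat with (S k) by lia.
  replace (N - 1 - k)%nat with (S (N - 1 - 1 - k)) by lia.
  set (n := (N - 1 - 1 - k)%nat).
  replace (_ - _) with (RtoC (par_c N (S k) - par_c N k) * RtoC (par_c N n)
    - RtoC (par_c N k) * RtoC (par_c N (S n) - par_c N n))
    by (rewrite !RtoC_minus; ring).
  replace (128 / h)%R with (8 / h * 8 + 8 * (8 / h))%R by (field; lra).
  apply Cmod_minus_le; apply Cmod_mult_le; rewrite Cmod_R;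
    (apply par_c_le || apply par_c_step).
Qed.

(** The price of replacing [eps = PI / N] by the chord [2 * sin (phi / 2)], for which the reference
    power is exactly scalar. The constant is [4 ^ 4], from [PI <= 4]. *)
Lemma par_cos_remainder : (Rabs (phi ^ 2 - (2 - 2 * cos phi)) <= 256 / h ^ 4)%R.
Proof.
  pose proof par_phi_bounds. pose proof par_h.
  pose proof (cos_taylor phi ltac:(rewrite Rabs_pos_eq; lra)).
  assert (Hp : (phi ^ 4 <= 256 / h ^ 4)%R).
  { replace (256 / h ^ 4)%R with ((4 / h) ^ 4)%R by (field; lra).
    apply pow_incr; split; [lra |]. unfold par_phi.
    apply Rmult_le_compat_r; [left; apply Rinv_0_lt_compat; lra | apply PI_4]. }
  assert (0 <= phi ^ 4)%R by (apply pow_le; lra).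
  apply Rabs_le; split; lra.
Qed.

End Parabolic.

Lemma cvg_parabolic (theta eps : nat -> nat -> C) (M1 Q1 : R) (N0 : nat) :
  (0 <= M1)%R ->
  (forall N k, in_range N k -> theta N k = 0) ->
  (forall N k, (N0 <= N)%nat -> (k < N)%nat ->
     (Cmod (eps N (S k) - PI / INR N) <= M1 / INR N ^ 2)%R) ->
  (forall N, (N0 <= N)%nat ->
     (Cmod (csum (fun k => RtoC (par_c N (N - 1 - k)) * RtoC (par_c N k)
                           * (eps N (S k) - PI / INR N))%C N)
      <= Q1 / INR N ^ 2)%R) ->
  cvg_unif_on_compacts (fun N => fcomp (theta N) (eps N) N) (fun z => z).
Proof.
  intros HM1 Hth He HQ.
  set (M2 := (M1 ^ 2 + 256)%R).
  set (M := (8 * M1 + M2)%R).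
  assert (HM2 : (0 <= M2)%R) by (unfold M2; nra).
  assert (HM : (0 <= M)%R) by (unfold M; lra).
  apply (cvg_of_model theta eps 8 M (8 * Q1 + 128 * M) (N0 + 4)); [lra | auto |].
  intros N HN.
  assert (HN4 : (4 <= N)%nat) by lia.
  pose proof (par_h N HN4) as Hh.
  assert (HhC : RtoC (INR N) <> 0) by (apply RtoC_neq_0; lra).
  set (phi := par_phi N).
  set (al := RtoC (2 * cos phi - 1)).
  set (be := RtoC (INR N * (2 - 2 * cos phi))).
  set (delta k := eps N (S k) - PI / INR N).
  set (rem k := delta k ^ 2 + RtoC (phi ^ 2 - (2 - 2 * cos phi))).
  (* Expansion of [eps ^ 2 = (phi + delta k) ^ 2] around [2 - 2 * cos phi]: [rem] is of order
     [1 / N ^ 4] and [sigma] of order [1 / N ^ 3]. *)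
  set (sigma k := 2 * RtoC phi * delta k + rem k).
  (* The field [md_u] ranges over all [k], whereas [theta] is known to vanish only in range; so [u]
     is defined by that equation and equals [- sigma] for [k < N]. *)
  set (u k := Cexp (2 * PI * Ci * theta N (S k)) - eps N (S k) ^ 2 - al).
  set (v k := INR N * sigma k).
  assert (HphiC : RtoC phi = PI / INR N).
  { unfold phi, par_phi. rewrite RtoC_div by lra. reflexivity. }
  assert (Hsig : forall k, eps N (S k) ^ 2 = RtoC (2 - 2 * cos phi) + sigma k).
  { intros k. unfold sigma, rem, delta. rewrite <- HphiC.
    rewrite !RtoC_minus, RtoC_pow. ring. }
  assert (Hu : forall k, (k < N)%nat -> u k = - sigma k).
  { intros k Hk. unfold u. rewrite Hth by (split; lia).
    rewrite Cexp_rot, Rmult_0_r, cos_0, sin_0, Hsig.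
    change (1%R, 0%R) with (RtoC 1). unfold al.
    rewrite !RtoC_minus. ring. }
  assert (Hdelta : forall k, (k < N)%nat -> (Cmod (delta k) <= M1 / INR N ^ 2)%R).
  { intros k Hk; apply He; lia. }
  assert (Hrem : forall k, (k < N)%nat -> (Cmod (rem k) <= M2 / INR N ^ 4)%R).
  { intros k Hk.
    replace (M2 / INR N ^ 4)%R with ((M1 / INR N ^ 2) ^ 2 + 256 / INR N ^ 4)%R
      by (unfold M2; field; lra).
    apply Cmod_plus_le.
    - rewrite Cmod_pow. apply pow_incr; split; [apply Cmod_ge_0 | auto].
    - rewrite Cmod_R. apply par_cos_remainder; auto. }
  assert (Hphi : (Cmod (2 * RtoC phi) <= 8 / INR N)%R).
  { rewrite <- RtoC_mult, Cmod_R. pose proof PI_RGT_0. pose proof PI_4.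
    unfold phi, par_phi.
    replace (2 * (PI / INR N))%R with (2 * PI / INR N)%R by (field; lra).
    assert (0 < / INR N)%R by (apply Rinv_0_lt_compat; lra).
    rewrite Rabs_pos_eq; [| apply Rdiv_le_0_compat; lra].
    apply Rmult_le_compat_r; lra. }
  assert (Hsigma : forall k, (k < N)%nat -> (Cmod (sigma k) <= M / INR N ^ 3)%R).
  { intros k Hk.
    apply Rle_trans with (8 / INR N * (M1 / INR N ^ 2) + M2 / INR N ^ 3)%R.
    - apply Cmod_plus_le; [apply Cmod_mult_le; auto |].
      eapply Rle_trans; [apply Hrem; auto |]. apply div_pow_le; auto; lra.
    - right; unfold M; field; lra. }
  destruct (par_init N) as (ia & ib & ic & id).
  destruct (par_end N HN4) as (ea & eb & ec & ed).
  exists al, be, (RtoC (-1)), (fun n => RtoC (par_a N n)), (fun n => RtoC (par_b N n)),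
    (fun n => RtoC (par_c N n)), (fun n => RtoC (par_d N n)), u, v.
  split.
  - rewrite ia; reflexivity.
  - rewrite ib; reflexivity.
  - rewrite ic; reflexivity.
  - rewrite id; reflexivity.
  - intros n. unfold al, be. rewrite <- !RtoC_mult, <- RtoC_plus.
    f_equal. apply par_aS; auto.
  - intros n. unfold al, be. rewrite <- !RtoC_mult, <- RtoC_plus.
    f_equal. apply par_bS; auto.
  - intros n. rewrite <- RtoC_inv by lra. rewrite <- RtoC_opp, <- RtoC_mult, <- RtoC_plus.
    f_equal. apply par_cS; auto.
  - intros n. rewrite <- RtoC_inv by lra. rewrite <- RtoC_opp, <- RtoC_mult, <- RtoC_plus.
    f_equal. apply par_dS; auto.
  - intros k. unfold u. ring.
  - intros k. unfold v, be. rewrite Hsig, RtoC_mult. ring.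
  - intros n _. rewrite Cmod_R. apply par_a_le; auto.
  - intros n _. rewrite Cmod_R. apply par_b_le; auto.
  - intros n _. rewrite Cmod_R. apply par_c_le; auto.
  - intros n _. rewrite Cmod_R. apply par_d_le; auto.
  - intros k Hk. rewrite Hu, Cmod_opp by auto. eapply Rle_trans; [apply Hsigma; auto |].
    apply div_pow_le; auto; lra.
  - intros k Hk. unfold v.
    replace (M / INR N ^ 2)%R with (INR N * (M / INR N ^ 3))%R by (field; lra).
    apply Cmod_mult_le; auto. rewrite Cmod_R, Rabs_pos_eq; lra.
  - rewrite ea; reflexivity.
  - rewrite eb; reflexivity.
  - rewrite ec; reflexivity.
  - rewrite ed; reflexivity.
  - rewrite Cmod_R, Rabs_left; lra.
  - set (c n := RtoC (par_c N n)).
    (* As [N * phi = PI], the leading part of [v k] is [2 * PI * delta k], whose weighted sum is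
       controlled by [HQ]; [N * rem] and [sigma] are of order [1 / N ^ 3]. *)
    rewrite (csum_ext _ (fun k => (2 * PI) * (c (N - 1 - k)%nat * c k * delta k)
      + c (N - 1 - k)%nat * (INR N * rem k * c k - sigma k * RtoC (par_a N k)))).
    2: { intros k Hk. rewrite Hu by auto.
         replace (v k) with (2 * PI * delta k + INR N * rem k)
           by (unfold v, sigma; rewrite HphiC; field; auto).
         unfold c; ring. }
    rewrite csum_plus, csum_scal.
    replace ((8 * Q1 + 128 * M) / INR N ^ 2)%R
      with (8 * (Q1 / INR N ^ 2) + INR N * (128 * M / INR N ^ 3))%R
      by (field; lra).
    apply Cmod_plus_le.
    + apply Cmod_mult_le.
      * rewrite <- RtoC_mult, Cmod_R. pose proof PI_RGT_0. pose proof PI_4.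
        rewrite Rabs_pos_eq; lra.
      * apply HQ; lia.
    + apply csum_le; intros k Hk.
      apply Rle_trans with (8 * (INR N * (M / INR N ^ 4) * 8 + M / INR N ^ 3 * 8))%R.
      * apply Cmod_mult_le; [unfold c; rewrite Cmod_R; apply par_c_le; auto |].
        apply Cmod_minus_le; apply Cmod_mult_le; auto.
        -- apply Cmod_mult_le; [rewrite Cmod_R, Rabs_pos_eq; lra |].
           eapply Rle_trans; [apply Hrem; auto |].
           apply Rmult_le_compat_r; [left; apply Rinv_0_lt_compat, pow_lt; lra |].
           unfold M; lra.
        -- unfold c; rewrite Cmod_R; apply par_c_le; auto.
        -- rewrite Cmod_R; apply par_a_le; auto.
      * right; field; lra.
Qed.

(** * The first-order sums in the five cases *)

Lemma csum_weighted_small (g delta : nat -> C) (N : nat) (G M : R) :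
  (0 < N)%nat ->
  (forall k, (k < N)%nat -> (Cmod (g k) <= G)%R) ->
  (forall k, (k < N)%nat -> (Cmod (delta k) <= M / INR N ^ 3)%R) ->
  (Cmod (csum (fun k => (g k * delta k)%C) N) <= G * M / INR N ^ 2)%R.
Proof.
  intros HN Hg Hd.
  apply Rle_trans with (INR N * (G * (M / INR N ^ 3)))%R.
  - apply csum_le; intros; apply Cmod_mult_le; auto.
  - right; field. apply not_0_INR; lia.
Qed.

Lemma csum_div_sqr (g c delta : nat -> C) (N : nat) (B : R) :
  (0 < N)%nat ->
  (forall k, (k < N)%nat -> delta k = c k / INR N ^ 2) ->
  (Cmod (csum (fun k => (g k * c k)%C) N) <= B)%R ->
  (Cmod (csum (fun k => (g k * delta k)%C) N) <= B / INR N ^ 2)%R.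
Proof.
  intros HN Hd HB.
  assert (Hh : (0 < INR N)%R) by (apply lt_0_INR; auto).
  assert (HhC : RtoC (INR N) <> 0) by (apply RtoC_neq_0; lra).
  rewrite (csum_ext _ (fun k => RtoC (/ INR N ^ 2) * (g k * c k))).
  - rewrite csum_scal, Cmod_mult, Cmod_R, Rabs_pos_eq.
    + rewrite Rmult_comm. apply Rmult_le_compat_r; auto.
      left; apply Rinv_0_lt_compat, pow_lt; auto.
    + left; apply Rinv_0_lt_compat, pow_lt; auto.
  - intros k Hk. rewrite Hd by auto.
    rewrite RtoC_inv by (apply pow_nonzero; lra). rewrite RtoC_pow. field; auto.
Qed.

Lemma Cmod_div_sqr (c : C) (N : nat) (B : R) :
  (0 < N)%nat -> (Cmod c <= B)%R -> (Cmod (c / INR N ^ 2) <= B / INR N ^ 2)%R.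
Proof.
  intros HN HB.
  assert (Hh : (0 < INR N)%R) by (apply lt_0_INR; auto).
  rewrite <- RtoC_pow, Cmod_div by (apply RtoC_neq_0, pow_nonzero; lra).
  rewrite Cmod_R, Rabs_pos_eq by (apply pow_le; lra).
  apply Rmult_le_compat_r; auto. left; apply Rinv_0_lt_compat, pow_lt; auto.
Qed.

Lemma Cmod_rot_weight_le (N k : nat) :
  (k < N)%nat -> (Cmod (rot_c N (N - 1 - k) * rotN N ^ k) <= 1)%R.
Proof.
  intros Hk. replace 1%R with (1 * 1)%R by ring. apply Cmod_mult_le.
  - apply Cmod_rot_c_le; lia.
  - rewrite Cmod_rotN_pow by lia; lra.
Qed.

Lemma cvg_rotation_cubic (theta eps : nat -> nat -> C) :
  bigO_inv in_range (fun N k => theta N k - 1 / INR N) 3 ->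
  bigO_inv in_range eps 2 ->
  cvg_unif_on_compacts (fun N => fcomp (theta N) (eps N) N) (fun z => z).
Proof.
  intros Ht He. destruct (bigO_inv_nonneg _ _ _ Ht) as (M & HM & Hd).
  apply (cvg_rotation theta eps M (1 * M) 1); auto.
  - intros N k HN Hk. eapply Rle_trans; [apply Hd; [lia | split; lia] |].
    apply div_pow_le; auto; apply (le_INR 1); auto.
  - intros N HN. apply csum_weighted_small; auto.
    + apply Cmod_rot_weight_le.
    + intros k Hk. apply Hd; [lia | split; lia].
Qed.

Lemma cvg_rotation_alternating (theta eps c : nat -> nat -> C) :
  (forall N k : nat, in_range N k -> theta N k = 1 / INR N + c N k / INR N ^ 2) ->
  unif_bounded c ->
  bigO_inv (fun N k => Nat.Odd k /\ in_range N k /\ in_range N (k + 1))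
    (fun N k => c N k + c N (k + 1)%nat) 1 ->
  bigO_inv in_range eps 2 ->
  cvg_unif_on_compacts (fun N => fcomp (theta N) (eps N) N) (fun z => z).
Proof.
  intros Ht [M0 HM0] Hc He.
  destruct (bigO_inv_nonneg _ _ _ Hc) as (M1 & HM1 & Hpair).
  set (M := Rmax M0 M1).
  assert (HM : (0 <= M)%R) by (apply Rle_trans with M1; [auto | apply Rmax_r]).
  assert (Hcb : forall N k, (k < N)%nat -> (Cmod (c N (S k)) <= M)%R).
  { intros N k Hk. eapply Rle_trans; [apply HM0; split; lia | apply Rmax_l]. }
  assert (Hd : forall N k, (k < N)%nat ->
    theta N (S k) - 1 / INR N = c N (S k) / INR N ^ 2).
  { intros N k Hk. rewrite Ht by (split; lia). ring. }
  (* The values 16 and 25 come from [rot_weight_variation], the factor 3 from [csum_pairing]. *)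
  apply (cvg_rotation theta eps M (3 * (25 * M)) 16); auto.
  - intros N k HN Hk. rewrite Hd by auto. apply Cmod_div_sqr; [lia | auto].
  - intros N HN. assert (HNp : (0 < N)%nat) by lia.
    apply (csum_div_sqr _ (fun k => c N (S k))); auto.
    apply csum_pairing; auto.
    + intros k Hk. eapply Rle_trans; [apply Cmod_rot_weight_le; auto | lra].
    + intros k Hk. apply rot_weight_variation; auto.
    + intros j Hj. replace (S (S (2 * j))) with (S (2 * j) + 1)%nat by lia.
      eapply Rle_trans.
      * apply Hpair; [auto |]. repeat split; try lia. exists j; lia.
      * rewrite pow_1. apply Rmult_le_compat_r; [| apply Rmax_r].
        left; apply Rinv_0_lt_compat, lt_0_INR; auto.
Qed.

(** The deviation at step [k] is [C0 * r ^ k / N ^ 2], so the first-order sum vanishes exactly by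
    [rot_resonant_sum]. *)
Lemma cvg_rotation_resonant (theta eps : nat -> nat -> C) (C0 : C) :
  (forall N k : nat, in_range N k -> theta N k =
     1 / INR N + C0 * Cexp (2 * PI * Ci * INR k / INR N) / INR N ^ 2) ->
  bigO_inv in_range eps 2 ->
  cvg_unif_on_compacts (fun N => fcomp (theta N) (eps N) N) (fun z => z).
Proof.
  intros Ht He.
  assert (Hd : forall N k, (k < N)%nat ->
    theta N (S k) - 1 / INR N = C0 * rotN N ^ S k / INR N ^ 2).
  { intros N k Hk. rewrite Ht, Cexp_rotN_pow by (try split; lia). ring. }
  apply (cvg_rotation theta eps (Cmod C0) 0 3); auto.
  - apply Cmod_ge_0.
  - intros N k HN Hk. rewrite Hd by auto. apply Cmod_div_sqr; [lia |].
    rewrite Cmod_mult, Cmod_rotN_pow by lia. lra.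
  - intros N HN.
    apply (csum_div_sqr _ (fun k => C0 * rotN N ^ S k)); [lia | auto |].
    rewrite (csum_ext _ (fun k => C0 * (rot_c N (N - 1 - k) * rotN N ^ k * rotN N ^ S k)))
      by (intros; ring).
    rewrite csum_scal, rot_resonant_sum by lia.
    rewrite Cmult_0_r, Cmod_0. lra.
Qed.

Lemma cvg_parabolic_cubic (theta eps : nat -> nat -> C) :
  (forall N k : nat, in_range N k -> theta N k = 0) ->
  bigO_inv in_range (fun N k => eps N k - PI / INR N) 3 ->
  cvg_unif_on_compacts (fun N => fcomp (theta N) (eps N) N) (fun z => z).
Proof.
  intros Ht He. destruct (bigO_inv_nonneg _ _ _ He) as (M & HM & Hd).
  apply (cvg_parabolic theta eps M (64 * M) 4); auto.
  - intros N k HN Hk. eapply Rle_trans; [apply Hd; [lia | split; lia] |].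
    apply div_pow_le; auto; apply (le_INR 1); lia.
  - intros N HN. apply csum_weighted_small; [lia | |].
    + intros k Hk. apply par_weight_le; auto.
    + intros k Hk. apply Hd; [lia | split; lia].
Qed.

Lemma cvg_parabolic_reflection (theta eps c : nat -> nat -> C) :
  (forall N k : nat, in_range N k -> theta N k = 0) ->
  (forall N k : nat, in_range N k -> eps N k = PI / INR N + c N k / INR N ^ 2) ->
  unif_bounded c ->
  bigO_inv (fun N k => (1 <= k <= N - 1)%nat) (fun N k => c N k + c N (N - k)%nat) 1 ->
  cvg_unif_on_compacts (fun N => fcomp (theta N) (eps N) N) (fun z => z).
Proof.
  intros Ht He [M0 HM0] Hc.
  destruct (bigO_inv_nonneg _ _ _ Hc) as (M1 & HM1 & Hpair).
  set (M := Rmax M0 M1).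
  assert (HM : (0 <= M)%R) by (apply Rle_trans with M1; [auto | apply Rmax_r]).
  assert (Hcb : forall N k, (k < N)%nat -> (Cmod (c N (S k)) <= M)%R).
  { intros N k Hk. eapply Rle_trans; [apply HM0; split; lia | apply Rmax_l]. }
  assert (Hd : forall N k, (k < N)%nat ->
    eps N (S k) - PI / INR N = c N (S k) / INR N ^ 2).
  { intros N k Hk. rewrite He by (split; lia). ring. }
  apply (cvg_parabolic theta eps M (128 * M + 64 * M) 4); auto.
  - intros N k HN Hk. rewrite Hd by auto. apply Cmod_div_sqr; [lia | auto].
  - intros N HN. assert (HNp : (0 < N)%nat) by lia.
    assert (Hh : (0 < INR N)%R) by (apply lt_0_INR; auto).
    apply (csum_div_sqr _ (fun k => c N (S k))); auto.
    (* The symmetry between [k] and [N - k] covers steps 1 to [N - 1]; step [N] is split off and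
       bounded by [64 * M]. *)
    destruct N as [| n]; [lia |]. cbn [csum].
    apply Cmod_plus_le.
    + apply (csum_reflection _ _ _ (INR (S n))); auto; try lra.
      * apply le_INR; lia.
      * intros k Hk. eapply Rle_trans; [apply par_weight_le; auto | lra].
      * intros k Hk. replace (n - 1 - k)%nat with (S n - 1 - 1 - k)%nat by lia.
        apply par_weight_reflection; [auto | lia].
      * intros k Hk. replace (S (n - 1 - k)) with (S n - S k)%nat by lia.
        eapply Rle_trans; [apply Hpair; [auto | lia] |].
        rewrite pow_1. apply Rmult_le_compat_r; [| apply Rmax_r].
        left; apply Rinv_0_lt_compat; auto.
    + apply Cmod_mult_le; [apply par_weight_le; auto | apply Hcb; lia].
Qed.

Theorem theorem2 (theta eps : nat -> nat -> C) :
  (* (1) *)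
  (bigO_inv in_range (fun N k => theta N k - 1 / INR N) 3 /\
   bigO_inv in_range eps 2)
  \/
  (* (2) *)
  ((exists c : nat -> nat -> C,
      (forall N k : nat, in_range N k ->
         theta N k = 1 / INR N + c N k / INR N ^ 2) /\
      unif_bounded c /\
      bigO_inv (fun N k => Nat.Odd k /\ in_range N k /\ in_range N (k + 1))
        (fun N k => c N k + c N (k + 1)%nat) 1) /\
   bigO_inv in_range eps 2)
  \/
  (* (3) *)
  ((exists C0 : C, forall N k : nat, in_range N k ->
      theta N k =
        1 / INR N + C0 * Cexp (2 * PI * Ci * INR k / INR N) / INR N ^ 2) /\
   bigO_inv in_range eps 2)
  \/
  (* (4) *)
  ((forall N k : nat, in_range N k -> theta N k = 0) /\
   bigO_inv in_range (fun N k => eps N k - PI / INR N) 3)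
  \/
  (* (5) *)
  ((forall N k : nat, in_range N k -> theta N k = 0) /\
   exists c : nat -> nat -> C,
     (forall N k : nat, in_range N k ->
        eps N k = PI / INR N + c N k / INR N ^ 2) /\
     unif_bounded c /\
     bigO_inv (fun N k => (1 <= k <= N - 1)%nat)
       (fun N k => c N k + c N (N - k)%nat) 1)
  ->
  cvg_unif_on_compacts (fun N => fcomp (theta N) (eps N) N) (fun z => z).
Proof.
  intros [[H1 H2] | [[(c & H1 & H2 & H3) H4] | [[[C0 H1] H2] |
    [[H1 H2] | [H1 (c & H2 & H3 & H4)]]]]].
  - apply cvg_rotation_cubic; assumption.
  - apply (cvg_rotation_alternating theta eps c); assumption.
  - apply (cvg_rotation_resonant theta eps C0); assumption.
  - apply cvg_parabolic_cubic; assumption.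
  - apply (cvg_parabolic_reflection theta eps c); assumption.
Qed.
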